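(* Let $\Omega\subset\mathbb{R}^N$ be a bounded domain (open connected set). Let $a\in C(\bar\Omega)\cap L^\infty(\Omega)$, and let $K:\Omega\times\Omega\to[0,\infty)$ be such that for every $x\in\Omega$ the map $K(x,\cdot)$ is measurable, for almost every $y\in\Omega$ the map $K(\cdot,y)$ is uniformly continuous, and there exist constants $r_0\ge r_1>0$, $C_0\ge c_0>0$ with $$C_0\,\mathbb{1}_{\Omega\cap B_{r_0}(x)}(y)\ \ge\ K(x,y)\ \ge\ c_0\,\mathbb{1}_{\Omega\cap B_{r_1}(x)}(y)\qquad\text{for all }x,y\in\Omega.$$ Then $$\lambda_p(\mathcal{L}_\Omega+a)=\lambda_p'(\mathcal{L}_\Omega+a)=\lambda_p''(\mathcal{L}_\Omega+a).$$ If in addition $K$ is symmetric ($K(x,y)=K(y,x)$), then $\lambda_p(\mathcal{L}_\Omega+a)=\lambda_v(\mathcal{L}_\Omega+a)$.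
   Context: For $\varphi\in C(\bar\Omega)$, $\mathcal{L}_\Omega[\varphi](x):=\int_\Omega K(x,y)\varphi(y)\,dy$, and $(\mathcal{L}_\Omega+a)\varphi:=\mathcal{L}_\Omega[\varphi]+a\varphi$. $B_r(x)$ is the open ball of radius $r$ centred at $x$ and $\mathbb{1}_A$ the indicator of $A$. The quantities are defined as: $\lambda_p(\mathcal{L}_\Omega+a):=\sup\{\lambda\in\mathbb{R}:\exists\varphi\in C(\bar\Omega),\ \varphi>0,\ \mathcal{L}_\Omega[\varphi]+a\varphi+\lambda\varphi\le0\text{ in }\Omega\}$; $\lambda_p'(\mathcal{L}_\Omega+a):=\inf\{\lambda\in\mathbb{R}:\exists\varphi\in C(\Omega)\cap L^\infty(\Omega),\ \varphi\ge0,\ \varphi\not\equiv0,\ \mathcal{L}_\Omega[\varphi]+(a+\lambda)\varphi\ge0\text{ in }\Omega\}$; $\lambda_p''(\mathcal{L}_\Omega+a):=\inf\{\lambda\in\mathbb{R}:\exists\varphi\in C_c(\Omega),\ \varphi\ge0,\ \varphi\not\equiv0,\ \mathcal{L}_\Omega[\varphi]+(a+\lambda)\varphi\ge0\text{ in }\Omega\}$ ($C_c(\Omega)$ = continuous functions with compact support in $\Omega$); $\lambda_v(\mathcal{L}_\Omega+a):=\inf_{\varphi\in L^2(\Omega),\varphi\not\equiv0}\ -\frac{\langle\mathcal{L}_\Omega[\varphi]+a\varphi,\varphi\rangle}{\|\varphi\|_{L^2(\Omega)}^2}$, where $\langle\cdot,\cdot\rangle$ is the $L^2(\Omega)$ scalar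 product. *)

(* Defs.v *)
From HB Require Import structures.
From mathcomp Require Import all_boot all_order all_algebra.
From mathcomp Require Import all_classical all_reals all_analysis.
Set Implicit Arguments. Unset Strict Implicit. Unset Printing Implicit Defensive.
Import Order.TTheory GRing.Theory Num.Theory.
Import numFieldNormedType.Exports.
Local Open Scope classical_set_scope.
Local Open Scope ring_scope.

(* R^N is modelled by 'rV[R]_N (library topology/normed structure).    *)
(* We equip it with its Borel sigma-algebra, i.e. the one generated by *)
(* the N coordinate projections (same construction the library uses   *)
(* for n.-tuple T).                                                     *)
Section rV_measurable.
Variables (R : realType) (N : nat).

Let coor : 'I_N -> 'rV[R]_N -> R := fun i x => x ord0 i.

Let rV_set0 : g_sigma_preimage coor set0.
Proof. exact: sigma_algebra0. Qed.

Let rV_setC A : g_sigma_preimage coor A -> g_sigma_preimage coor (~` A).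
Proof. exact: sigma_algebraC. Qed.

Let rV_bigcup (F : (set 'rV[R]_N)^nat) :
  (forall i, g_sigma_preimage coor (F i)) ->
  g_sigma_preimage coor (\bigcup_i (F i)).
Proof. exact: sigma_algebra_bigcup. Qed.

HB.instance Definition _ := @isMeasurable.Build
  (measure_tuple_display default_measure_display)
  'rV[R]_N (g_sigma_preimage coor) rV_set0 rV_setC rV_bigcup.

End rV_measurable.

Section defs.
Variables (R : realType) (N : nat).
Local Notation V := 'rV[R]_N.

Definition enorm (x : V) : R := Num.sqrt (\sum_(i < N) (x ord0 i) ^+ 2).
Definition eball (x : V) (r : R) : set V := [set y | enorm (y - x) < r].

(* mu is the Lebesgue measure on R^N: it gives every half-open box its   *)
(* Euclidean volume (this characterizes Lebesgue measure on Borel sets). *)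
Definition is_lebesgue (mu : {measure set V -> \bar R}) : Prop :=
  forall a b : V, (forall i, a ord0 i <= b ord0 i) ->
    mu [set x | forall i, a ord0 i <= x ord0 i < b ord0 i] =
    (\prod_(i < N) (b ord0 i - a ord0 i))%:E.

Variable mu : {measure set V -> \bar R}.

(* Lebesgue measurability on D: a.e. equal (on D) to a Borel function, *)
(* i.e. measurability w.r.t. the completion of mu.                     *)
Definition lmeasurable_fun (D : set V) (f : V -> R) : Prop :=
  exists g : V -> R, measurable_fun D g /\ {ae mu, forall y, D y -> f y = g y}.

Definition Linfty (D : set V) (f : V -> R) : Prop :=
  lmeasurable_fun D f /\ exists M : R, {ae mu, forall y, D y -> `|f y| <= M}.

Definition L2 (D : set V) (f : V -> R) : Prop :=
  lmeasurable_fun D f /\ (\int[mu]_(y in D) ((f y) ^+ 2)%:E < +oo)%E.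

Definition Lop (Om : set V) (K : V -> V -> R) (phi : V -> R) (x : V) : R :=
  Rintegral mu Om (fun y => K x y * phi y).

Definition C_closure (Om : set V) (phi : V -> R) : Prop :=
  {within closure Om, continuous phi}.

Definition C_c (Om : set V) (phi : V -> R) : Prop :=
  {within Om, continuous phi} /\
  compact (closure [set x | Om x /\ phi x != 0]) /\
  closure [set x | Om x /\ phi x != 0] `<=` Om.

Variables (Om : set V) (K : V -> V -> R) (a : V -> R).

Definition lambda_p : \bar R :=
  ereal_sup [set l%:E | l in [set l : R | exists phi : V -> R,
    [/\ C_closure Om phi, (forall x, closure Om x -> 0 < phi x) &
        forall x, Om x -> Lop Om K phi x + a x * phi x + l * phi x <= 0]]].

Definition lambda_p' : \bar R :=
  ereal_inf [set l%:E | l in [set l : R | exists phi : V -> R,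
    [/\ {within Om, continuous phi}, Linfty Om phi,
        (forall x, Om x -> 0 <= phi x), (exists x, Om x /\ phi x != 0) &
        forall x, Om x -> 0 <= Lop Om K phi x + (a x + l) * phi x]]].

Definition lambda_p'' : \bar R :=
  ereal_inf [set l%:E | l in [set l : R | exists phi : V -> R,
    [/\ C_c Om phi,
        (forall x, Om x -> 0 <= phi x), (exists x, Om x /\ phi x != 0) &
        forall x, Om x -> 0 <= Lop Om K phi x + (a x + l) * phi x]]].

Definition lambda_v : \bar R :=
  ereal_inf [set q%:E | q in [set q : R | exists phi : V -> R,
    [/\ L2 Om phi, ~ {ae mu, forall y, Om y -> phi y = 0} &
        q = - Rintegral mu Om (fun x => (Lop Om K phi x + a x * phi x) * phi x)
              / Rintegral mu Om (fun x => phi x ^+ 2)]]].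

End defs.

(* Main.v *)
Require Import Defs.
From HB Require Import structures.
From mathcomp Require Import all_boot all_order all_algebra.
From mathcomp Require Import all_classical all_reals all_analysis.
From mathcomp Require Import measurable_realfun.
From mathcomp Require finmap.
From mathcomp Require Import ring lra.
Set Implicit Arguments. Unset Strict Implicit. Unset Printing Implicit Defensive.
Import Order.TTheory GRing.Theory Num.Theory.
Import numFieldNormedType.Exports.
Local Open Scope classical_set_scope.
Local Open Scope ring_scope.

(** A supersolution [phi] at level [l] touches any bounded subsolution [psi] at
    level [l'] from above, which forces [l <= l']; hence
    [lambda_p <= lambda_p' <= lambda_p''].  Conversely let [Ls = lambda_p].  If
    [a + Ls + e > 0] somewhere, a bump function supported there is a subsolution
    at [Ls + e].  Otherwise [- a - l] is bounded below for [l = Ls - d], and the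
    monotone iteration [u := (1 + L u) / (- a - l)], dominated by a
    supersolution, converges to [u] with [L u + (a + l) u = -1]; maximality of
    [Ls] gives [sup u >= 1 / d].  The normalised [v = u / sup u] satisfies a
    Harnack inequality with constants independent of [d], so the gain [e v] beats
    both the error [- 1 / sup u] and the error made by cutting [v] off near the
    boundary.  For symmetric [K], compactly supported subsolutions are test
    functions for the Rayleigh quotient, and supersolutions bound it below by
    AM-GM. *)

(** Multiplication by [a] destroys compactness, so a positive eigenfunction at the level [lambda_p]
    need not exist. Hence the approximate eigenfunctions at levels [Ls - d], and hence the order of
    choices: the Harnack constant depends on [Om], the lower kernel bound, [a] and [Ls], so [d] and
    the cutoff can be chosen after it. The second obstacle is measurability. Each [K x] is only
    almost everywhere equal to a Borel function, off a null set depending on [x], and nothing is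
    assumed jointly in both variables. The kernel is replaced by a Borel version [k] that defines
    the same operator at every point of [Om]. Its regularity in [x] survives only along countably
    many points at a time; this still lets dominated convergence show that [L f] is uniformly
    continuous, and the continuity of solutions is then read off from the equation they solve. *)

(** * Integration: almost everywhere equal integrands, domination, finite sums *)

Section integral_lemmas.
Context d (T : measurableType d) (R : realType).
Variable mu : {measure set T -> \bar R}.
Implicit Types (D : set T) (f g : T -> R).

Import HBNNSimple.

(* Neither function is assumed measurable: simple functions below [f] are multiplied by the indicator of the complement of [Z]. *)
Lemma le_integral_negligible (f g : T -> \bar R) (Z : set T) :
  measurable Z -> mu Z = 0%E -> (forall x, (0 <= f x)%E) ->
  (forall x, (0 <= g x)%E) -> (forall x, ~ Z x -> f x = g x) ->
  (\int[mu]_x f x <= \int[mu]_x g x)%E.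
Proof.
move=> mZ Z0 f0 g0 fg.
rewrite ge0_integralTE// ge0_integralTE//; apply: ge_ereal_sup => _ [h hf <-].
have mZC : measurable (~` Z) by exact: measurableC.
apply: ereal_sup_ge.
exists (sintegral mu (proj_nnsfun h mZC)); last first.
  have -> : sintegral mu h = (\int[mu]_x (h x)%:E)%E.
    by rewrite integral_nnsfun// patch_setT.
  have -> : sintegral mu (proj_nnsfun h mZC) =
      (\int[mu]_x ((proj_nnsfun h mZC) x)%:E)%E.
    by rewrite integral_nnsfun// patch_setT.
  rewrite le_eqVlt; apply/orP; left; apply/eqP.
  apply: ge0_ae_eq_integral => //.
  - exact/measurable_EFinP.
  - exact/measurable_EFinP.
  - by move=> x _; rewrite lee_fin.
  - by move=> x _; rewrite lee_fin.
  exists Z; split => // x /= H; apply: contrapT => Zx; apply: H => _.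
  by rewrite mindicE mem_set// mulr1.
exists (proj_nnsfun h mZC) => //= x; rewrite mindicE.
have [xZ|xZ] := boolP (x \in ~` Z); last by rewrite mulr0.
by rewrite mulr1 -fg//; exact/set_mem.
Qed.

(** Stated for arbitrary functions because the integrands [K x y * phi y] of [Lop] are only almost
    everywhere equal to Borel functions. The positive and negative parts are compared separately, in
    both directions. *)
Lemma integral_ae_eq D f g :
  {ae mu, forall x, D x -> f x = g x} ->
  (\int[mu]_(x in D) (f x)%:E = \int[mu]_(x in D) (g x)%:E)%E.
Proof.
move=> [Z [mZ Z0 fg]].
have E x : ~ Z x -> ((EFin \o f) \_ D) x = ((EFin \o g) \_ D) x.
  move=> nZ; rewrite /patch; case: ifPn => // /set_mem Dx /=.
  by have := contra_notP (fg x) nZ => /(_ Dx) ->.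
suff H (f1 g1 : T -> \bar R) : (forall x, ~ Z x -> f1 x = g1 x) ->
   ((\int[mu]_x f1^\+ x)%E = (\int[mu]_x g1^\+ x)%E) /\
   ((\int[mu]_x f1^\- x)%E = (\int[mu]_x g1^\- x)%E).
  rewrite integral_mkcond [RHS]integral_mkcond.
  rewrite integralE [RHS]integralE.
  by have [-> ->] := H _ _ E.
move=> fg1; split; apply/eqP; rewrite eq_le; apply/andP; split;
  apply: (le_integral_negligible mZ Z0) => //; move=> x nZ;
  by rewrite ?funeposE ?funenegE fg1.
Qed.

Lemma Rintegral_ae_eq D f g :
  {ae mu, forall x, D x -> f x = g x} ->
  \int[mu]_(x in D) f x = \int[mu]_(x in D) g x.
Proof. by move=> fg; rewrite /Rintegral (integral_ae_eq fg). Qed.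

Lemma Rintegral_dominated_cvg D (f_ : nat -> T -> R) f g :
  measurable D -> (forall n, measurable_fun D (f_ n)) -> measurable_fun D f ->
  {ae mu, forall x, D x -> f_ n x @[n --> \oo] --> f x} ->
  mu.-integrable D (EFin \o g) ->
  (forall n x, D x -> `|f_ n x| <= g x) ->
  \int[mu]_(x in D) f_ n x @[n --> \oo] --> \int[mu]_(x in D) f x.
Proof.
move=> mD mf_ mf cf ig fg.
have ifn n : mu.-integrable D (EFin \o f_ n).
  apply: le_integrable ig => //; first exact/measurable_EFinP.
  move=> x Dx /=; rewrite lee_fin; apply: le_trans (fg _ _ Dx) _.
  exact: ler_norm.
have [|||||i _ H] := @dominated_convergence _ _ _ mu D mD
    (fun n => EFin \o f_ n) (EFin \o f) (EFin \o g).
- by move=> n; exact/measurable_EFinP.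
- exact/measurable_EFinP.
- by apply: filterS cf => x + Dx => /(_ Dx) c; apply: cvg_EFin => //; near=> n.
- exact: ig.
- by apply: aeW => x n Dx; rewrite lee_fin; exact: fg.
apply: fine_cvg.
rewrite fineK //; exact: integrable_fin_num.
Unshelve. all: by end_near. Qed.

Lemma bounded_integrable D f (M : R) : measurable D -> (mu D < +oo)%E ->
  measurable_fun D f -> (forall x, D x -> `|f x| <= M) ->
  mu.-integrable D (EFin \o f).
Proof.
move=> mD muD mf fM; apply: measurable_bounded_integrable => //.
exists M; split; first exact: num_real.
by move=> r Mr x Dx; apply: le_trans (fM _ Dx) (ltW Mr).
Qed.

Lemma integrableM_bounded D (h f : T -> R) (M : R) : measurable D ->
  measurable_fun D h -> (forall x, D x -> `|h x| <= M) ->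
  mu.-integrable D (EFin \o f) ->
  mu.-integrable D (EFin \o (fun x => h x * f x)).
Proof.
move=> mD mh hM fi.
have := @integrableMr _ _ _ mu D mD h _ mh _ fi; apply.
exists M; split; first exact: num_real.
by move=> r Mr x Dx; apply: le_trans (hM _ Dx) (ltW Mr).
Qed.

Lemma integrable_fun_measurable D f :
  mu.-integrable D (EFin \o f) -> measurable_fun D f.
Proof. by move=> /integrableP[/measurable_EFinP]. Qed.

Lemma le_integrableR D f g : measurable D -> measurable_fun D f ->
  (forall x, D x -> `|f x| <= g x) ->
  mu.-integrable D (EFin \o g) -> mu.-integrable D (EFin \o f).
Proof.
move=> mD mf fg; apply: le_integrable => //; first exact/measurable_EFinP.
by move=> x Dx; rewrite lee_fin (le_trans (fg _ Dx))// ler_norm.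
Qed.

Lemma integrableDR D f g : measurable D ->
  mu.-integrable D (EFin \o f) -> mu.-integrable D (EFin \o g) ->
  mu.-integrable D (EFin \o (fun x => f x + g x)).
Proof.
by move=> mD fi gi; have := integrableD mD fi gi; apply: eq_integrable.
Qed.

Lemma integrableBR D f g : measurable D ->
  mu.-integrable D (EFin \o f) -> mu.-integrable D (EFin \o g) ->
  mu.-integrable D (EFin \o (fun x => f x - g x)).
Proof.
by move=> mD fi gi; have := integrableB mD fi gi; apply: eq_integrable.
Qed.

Lemma integrableZR D f c : measurable D ->
  mu.-integrable D (EFin \o f) ->
  mu.-integrable D (EFin \o (fun x => c * f x)).
Proof.
by move=> mD fi; have := integrableZl mD c fi; apply: eq_integrable.
Qed.

Lemma Rintegral_eq0_ae D f : measurable D ->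
  mu.-integrable D (EFin \o f) -> (forall x, D x -> 0 <= f x) ->
  \int[mu]_(x in D) f x = 0 -> {ae mu, forall x, D x -> f x = 0}.
Proof.
move=> mD fi f0 If.
have mf := integrable_fun_measurable fi.
have H : (\int[mu]_(x in D) `|(f x)%:E| = 0)%E.
  rewrite (eq_integral (EFin \o f)).
    rewrite -(fineK (integrable_fin_num mD fi)); congr (_ %:E); exact: If.
  by move=> x /set_mem Dx /=; rewrite ger0_norm// f0.
have /(ae_eq_integral_abs mu mD) := H.
move=> /(_ ((measurable_EFinP _ _).2 mf)); apply: filterS => x h Dx.
by have [] := h Dx.
Qed.

Lemma integrable_sum_seq (I : eqType) (s : seq I) D (F : I -> T -> R) :
  measurable D -> (forall i, i \in s -> mu.-integrable D (EFin \o F i)) ->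
  mu.-integrable D (EFin \o (fun x => \sum_(i <- s) F i x)) /\
  \int[mu]_(x in D) (\sum_(i <- s) F i x) =
  \sum_(i <- s) \int[mu]_(x in D) F i x.
Proof.
move=> mD; elim: s => [|i s IH] Fi.
  rewrite big_nil; split.
    apply: (@eq_integrable _ _ _ _ _ mD (EFin \o cst 0)).
      by move=> x _; rewrite /= big_nil.
    exact: integrable0.
  under eq_Rintegral do rewrite big_nil.
  by rewrite Rintegral_cst// mul0r.
have [|i1 IH1] := IH; first by move=> j js; apply: Fi; rewrite in_cons js orbT.
have i2 := Fi i (mem_head _ _).
split.
  apply: (@eq_integrable _ _ _ _ _ mD
    (EFin \o (fun x => F i x + \sum_(j <- s) F j x))).
    by move=> x _; rewrite /= big_cons.
  exact: integrableDR.
under eq_Rintegral do rewrite big_cons.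
by rewrite RintegralD// IH1 big_cons.
Qed.

End integral_lemmas.

(** * Borel sets and Lebesgue measure on row vectors *)

Section euclidean_space.
Context (R : realType) (N : nat).
Local Notation V := 'rV[R]_N.
Implicit Types x y : V.

Lemma normr_coord_le x i : `|x ord0 i| <= `|x|.
Proof.
by rewrite [leRHS]/Num.norm /= mx_normrE; exact: (le_bigmax _ _ (ord0, i)).
Qed.

Lemma normr_coord_lt x e : 0 < e -> (forall i, `|x ord0 i| < e) -> `|x| < e.
Proof.
move=> e0 H; rewrite [ltLHS]/Num.norm /= mx_normrE; apply: bigmax_lt => //.
by move=> [i j] _ /=; rewrite (ord1 i).
Qed.

Lemma enorm_le x : enorm x <= N%:R * `|x|.
Proof.
have H0 : 0 <= N%:R * `|x| :> R by rewrite mulr_ge0.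
rewrite /enorm -(ger0_norm H0) -sqrtr_sqr ler_wsqrtr//.
apply: (@le_trans _ _ (\sum_(i < N) `|x| ^+ 2)).
  apply: ler_sum => i _; rewrite -[leLHS]ger0_norm ?sqr_ge0// normrX.
  by rewrite lerXn2r ?nnegrE// normr_coord_le.
rewrite sumr_const card_ord exprMn -[leLHS]mulr_natl.
apply: ler_wpM2r; first exact: sqr_ge0.
case: (N) => [|n]; first by rewrite expr0n.
by rewrite -natrX ler_nat expnS expn1 leq_pmulr.
Qed.

(** Distances are measured below in the sup norm of rows, whereas the theorem uses the Euclidean
    norm. This direction of the equivalence transfers both the lower kernel bound and the uniform
    continuity in [x]. *)
Lemma normr_lt_enorm (d : R) : 0 < d ->
  exists2 d' : R, 0 < d' & forall x, `|x| < d' -> enorm x < d.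
Proof.
(* The successor keeps the radius positive when [N = 0]. *)
move=> d0; exists (d / N.+1%:R); first by rewrite divr_gt0.
move=> x xd; apply: le_lt_trans (enorm_le x) _.
have [->|x0] := eqVneq x 0; first by rewrite normr0 mulr0.
apply: (@lt_le_trans _ _ (N.+1%:R * `|x|)).
  by rewrite ltr_pM2r ?normr_gt0// ltr_nat.
by rewrite mulrC -ler_pdivlMr// ltW.
Qed.

Lemma measurable_coord i : measurable_fun [set: V] (fun x => x ord0 i).
Proof.
move=> _ Y mY; rewrite setTI; apply: sub_sigma_algebra.
rewrite (bigD1 i)//=; left; exists Y => //; exact: setTI.
Qed.


Lemma measurable_box (Y : 'I_N -> set R) :
  (forall i, measurable (Y i)) -> measurable [set x : V | forall i, Y i (x ord0 i)].
Proof.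
move=> mY.
rewrite (_ : mkset _ =
    \bigcap_(i in [set: 'I_N]) ((fun x : V => x ord0 i) @^-1` Y i)); last first.
  by apply/seteqP; split => [x H i _|x H i]; apply: H.
apply: fin_bigcap_measurable => // i _.
by rewrite -[X in measurable X]setTI; exact: measurable_coord.
Qed.

Lemma measurable_normr_ball (c : V) e : measurable [set x : V | `|x - c| < e].
Proof.
have [e0|e0] := leP e 0.
  rewrite (_ : mkset _ = set0)//; apply/seteqP; split => // x /=.
  by rewrite ltNge (le_trans e0).
rewrite (_ : mkset _ = [set x : V | forall i, ball (c ord0 i) e (x ord0 i)]).
  apply: (measurable_box (Y := fun i => ball (c ord0 i) e)) => i.
  exact: measurable_ball.
apply/seteqP; split => x /=.
  move=> xc i; rewrite /ball/= distrC; apply: le_lt_trans xc.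
  by have := normr_coord_le (x - c) i; rewrite !mxE.
by move=> H; apply: normr_coord_lt => // i; rewrite !mxE distrC; exact: H.
Qed.

Lemma rV_rat_dense (x : V) (e : R) : 0 < e ->
  exists q : 'rV[rat]_N, `|x - map_mx ratr q| < e.
Proof.
move=> e0.
have H i : {q : rat | `|x ord0 i - ratr q| < e}.
  have /rat_in_itvoo /cid[q] : x ord0 i - e < x ord0 i + e by lra.
  by rewrite in_itv/= => /andP[h1 h2]; exists q; rewrite ltr_norml; lra.
exists (\row_i projT1 (H i)); apply: normr_coord_lt => // i.
by rewrite !mxE; exact: (projT2 (H i)).
Qed.

Lemma nbhs_normr_ball (x : V) (U : set V) : nbhs x U ->
  exists2 e : R, 0 < e & forall y, `|y - x| < e -> U y.
Proof.
move=> /nbhs_ballP[e /= e0 H]; exists e => // y xy; apply: H => /=.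
by rewrite -ball_normE /= distrC.
Qed.

Lemma normr_ball_nbhs (x : V) (e : R) : 0 < e -> nbhs x [set y | `|y - x| < e].
Proof.
move=> e0; apply/nbhs_ballP; exists e => //= y.
by rewrite -ball_normE /= distrC.
Qed.

(** The sigma-algebra is generated by the coordinates, so sup-norm balls are measurable boxes; [U]
    is the countable union of those with rational centre and radius [1 / (n + 1)] that it
    contains. *)
Lemma open_measurable_rV (U : set V) : open U -> measurable U.
Proof.
move=> oU.
pose B (p : 'rV[rat]_N * nat) : set V :=
  [set x | `|x - map_mx ratr p.1| < p.2.+1%:R^-1].
rewrite (_ : U = \bigcup_(p in [set: 'rV[rat]_N * nat])
   (if pselect (B p `<=` U) then B p else set0)); last first.
  apply/seteqP; split => [x Ux|x [p _]]; last by case: pselect => // h /h.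
  have [e e0 He] := nbhs_normr_ball (open_nbhs_nbhs (conj oU Ux)).
  have [n ne] : exists n, (n.+1%:R^-1 : R) < e / 2.
    have e20 : 0 < e / 2 by rewrite divr_gt0.
    have [n _ /(_ _ (leqnn n)) H] := near_infty_natSinv_lt (PosNum e20).
    by exists n.
  have [q xq] : exists q : 'rV[rat]_N, `|x - map_mx ratr q| < n.+1%:R^-1.
    exact: rV_rat_dense.
  exists (q, n) => //; case: pselect => //= -[] y yq; apply: He.
  rewrite -(subrKA (map_mx ratr q)) (le_lt_trans (ler_normD _ _))//.
  by rewrite [X in _ + X]distrC [e]splitr ltrD// (lt_trans _ ne).
apply: countable_bigcupT_measurable => [|p]; first exact: countableP.
by case: pselect => h; [exact: measurable_normr_ball|exact: measurable0].
Qed.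

Lemma continuous_measurable_within (D : set V) (f : V -> R) :
  open D -> {within D, continuous f} -> measurable_fun D f.
Proof.
move=> oD /continuousP cf; apply: (measurability _ (RGenOpens.measurableE R)).
move=> _ [_ [a [b ->] <-]].
have oab : open (`]a, b[%classic : set R) by exact: interval_open.
have /open_subspaceP[W oW WD] := cf _ oab.
by rewrite setIC -WD; apply: open_measurable_rV; exact: openI.
Qed.

Section lebesgue.
Variable mu : {measure set V -> \bar R}.
Hypothesis lmu : is_lebesgue mu.

Lemma lebesgue_bounded_lty (D : set V) : measurable D -> bounded_set D ->
  (mu D < +oo)%E.
Proof.
move=> mD [M [_ HM]].
have M0 : 0 < `|M| + 1 by rewrite ltr_wpDl.
have DM x : D x -> `|x| <= `|M| + 1.
  by apply: HM; rewrite (le_lt_trans (ler_norm _))// ltrDl.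
pose b : V := const_mx (`|M| + 2).
have := lmu (a := - b) (b := b).
set Q := mkset _ => muQ.
apply: (@le_lt_trans _ _ (mu Q)).
  apply: le_measure; rewrite ?inE//.
    apply: (measurable_box (Y := fun i => [set` `[(- b) ord0 i, b ord0 i[])) => i.
    exact: measurable_itv.
  move=> x Dx i; rewrite /= !mxE.
  have := le_trans (normr_coord_le x i) (DM _ Dx).
  by rewrite ler_norml => /andP[h1 h2]; apply/andP; split; lra.
rewrite muQ ?ltry// => i; rewrite !mxE; have := normr_ge0 M; lra.
Qed.

Lemma lebesgue_open_gt0 (U : set V) : open U -> U !=set0 -> (0 < mu U)%E.
Proof.
move=> oU [x Ux].
have [e e0 He] := nbhs_normr_ball (open_nbhs_nbhs (conj oU Ux)).
pose b : V := x + const_mx (e / 2).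
have := lmu (a := x) (b := b).
set Q := mkset _ => muQ.
apply: (@lt_le_trans _ _ (mu Q)).
  rewrite muQ => [|i]; rewrite ?mxE; last lra.
  by rewrite lte_fin; apply: prodr_gt0 => i _; rewrite !mxE; lra.
apply: le_measure; rewrite ?inE//.
- apply: (measurable_box (Y := fun i => [set` `[x ord0 i, b ord0 i[])) => i.
  exact: measurable_itv.
- exact: open_measurable_rV.
move=> y Qy; apply: He; apply: normr_coord_lt => // i.
by have := Qy i; rewrite !mxE => /andP[h1 h2]; rewrite ltr_norml; lra.
Qed.

End lebesgue.
End euclidean_space.

(** * Uniform continuity, extension to the closure, finite nets and chains *)

Section topology.
Context (R : realType) (N : nat).
Local Notation V := 'rV[R]_N.
Implicit Types (x y : V) (D Om : set V) (f : V -> R).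

Definition unif_continuous_on D f := forall e : R, 0 < e ->
  exists2 d : R, 0 < d & forall x y, D x -> D y -> `|x - y| < d ->
    `|f x - f y| < e.

Lemma within_continuous_normP D f : {within D, continuous f} <->
  forall x, D x -> forall e : R, 0 < e -> exists2 d : R, 0 < d &
    forall y, D y -> `|y - x| < d -> `|f y - f x| < e.
Proof.
rewrite subspace_continuousP; split=> H x Dx.
  move=> e e0; have /cvgrPdist_lt/(_ _ e0) := H x Dx.
  move=> /nbhs_normr_ball[d d0 Hd]; exists d => // y Dy yx.
  by rewrite distrC; exact: Hd.
apply/cvgrPdist_lt => e e0; have [d d0 Hd] := H x Dx e e0.
have := normr_ball_nbhs x d0; apply: filterS => y yx Dy.
by rewrite distrC; exact: Hd.
Qed.

Lemma unif_continuous_within D f :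
  unif_continuous_on D f -> {within D, continuous f}.
Proof.
move=> uf; apply/within_continuous_normP => x Dx e /uf[d d0 Hd].
by exists d => // y Dy; exact: Hd.
Qed.

Lemma closure_normr D x : closure D x -> forall e : R, 0 < e ->
  exists2 y, D y & `|y - x| < e.
Proof.
by move=> cx e e0; have [y [Dy yx]] := cx _ (normr_ball_nbhs x e0); exists y.
Qed.

Lemma unif_continuous_extension D f : unif_continuous_on D f ->
  exists g : V -> R, [/\ {within closure D, continuous g},
    (forall x, D x -> g x = f x) &
    (forall c, (forall x, D x -> c <= f x) ->
       forall x, closure D x -> c <= g x)].
Proof.
move=> uf.
pose F x := f @ within D (nbhs x).
pose g x := lim (F x).
have PF x : closure D x -> ProperFilter (F x).
  by move=> cx; have := within_nbhs_proper cx => h; exact: fmap_proper_filter.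
have near_F x d (P : set R) : 0 < d ->
    (forall y, D y -> `|y - x| < d -> P (f y)) -> F x P.
  move=> d0 H; have := normr_ball_nbhs x d0.
  by apply: filterS => y yx Dy; exact: H.
have Fg x : closure D x -> F x --> g x.
  move=> cx; have := PF x cx => PFx; apply/cauchy_cvgP; apply/cauchy_exP => e e0.
  have [d d0 Hd] := uf e e0.
  have d20 : 0 < d / 2 by rewrite divr_gt0.
  have [z Dz zx] := closure_normr cx d20.
  exists (f z); apply: (near_F _ (d / 2)) => // y Dy yx.
  rewrite /ball/=; apply: Hd => //; rewrite -(subrKA x).
  rewrite (le_lt_trans (ler_normD _ _))// [X in _ + X]distrC [d]splitr.
  by rewrite ltrD.
(* One modulus compares [g] at a point of the closure with [f] at nearby points of [D]. Continuity
   of [g], agreement with [f] on [D] and the transfer of lower bounds all follow from it. *)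
have key e : 0 < e -> exists2 d : R, 0 < d &
    forall x y, closure D x -> D y -> `|y - x| < d -> `|g x - f y| <= e.
  move=> e0; have [d d0 Hd] := uf e e0; exists (d / 2); first by rewrite divr_gt0.
  move=> x y cx Dy yx; have := PF x cx => PFx.
  apply/ler_addgt0Pr => e' e'0.
  have F1 : F x [set t | `|g x - t| < e'].
    by have /cvgrPdist_lt := Fg x cx; exact.
  have F2 : F x [set t | `|t - f y| < e].
    apply: (near_F _ (d / 2)); first by rewrite divr_gt0.
    move=> z Dz zx; apply: Hd => //; rewrite -(subrKA x).
    rewrite (le_lt_trans (ler_normD _ _))// [X in _ + X]distrC [d]splitr.
    by rewrite ltrD.
  have [t [/= t1 t2]] := filter_ex (filterI F1 F2).
  rewrite -(subrKA t) (le_trans (ler_normD _ _))// addrC.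
  by apply: lerD; exact: ltW.
exists g; split.
- apply/within_continuous_normP => x cx e e0.
  have e30 : 0 < e / 3 by rewrite divr_gt0.
  have [d d0 Hd] := key _ e30; exists (d / 2); first by rewrite divr_gt0.
  move=> y cy yx.
  have d20 : 0 < d / 2 by rewrite divr_gt0.
  have [z Dz zy] := closure_normr cy d20.
  have h1 : `|g y - f z| <= e / 3 by apply: Hd => //; lra.
  have h2 : `|g x - f z| <= e / 3.
    apply: Hd => //; rewrite -(subrKA y) (le_lt_trans (ler_normD _ _))//.
    by rewrite [d]splitr ltrD.
  rewrite -(subrKA (f z)) (le_lt_trans (ler_normD _ _))//.
  by rewrite [X in _ + X]distrC; lra.
- move=> x Dx; apply/eqP; rewrite -subr_eq0 -normr_le0; apply/ler_addgt0Pr => e e0.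
  rewrite add0r; have [d d0 Hd] := key _ e0; apply: Hd => //.
    exact: subset_closure.
  by rewrite subrr normr0.
- move=> c cf x cx; apply/ler_addgt0Pr => e e0.
  have [d d0 Hd] := key _ e0; have [z Dz zx] := closure_normr cx d0.
  have := Hd _ _ cx Dz zx; have := cf _ Dz.
  by rewrite ler_norml; lra.
Qed.

(** Negating uniform continuity at the scales [1 / (n + 1)] produces two sequences. This form asks
    for information along countably many points only, which is what [kernel_seq] provides. *)
Lemma unif_continuous_seq D f :
  (forall x y : nat -> V, (forall n, D (x n)) -> (forall n, D (y n)) ->
     (forall n, `|x n - y n| < n.+1%:R^-1) ->
     f (x n) - f (y n) @[n --> \oo] --> 0) ->
  unif_continuous_on D f.
Proof.
move=> H e e0; apply: contrapT => nd.
have {nd} /choice[u Hu] : forall n : nat, exists p : V * V,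
    [/\ D p.1, D p.2, `|p.1 - p.2| < n.+1%:R^-1 & e <= `|f p.1 - f p.2|].
  move=> n; apply: contrapT => np; apply: nd; exists n.+1%:R^-1 => // x y Dx Dy xy.
  by rewrite ltNge; apply/negP => ef; apply: np; exists (x, y).
have /cvgrPdist_lt/(_ _ e0)[n _ /(_ _ (leqnn n)) /=] :=
  H (fun n => (u n).1) (fun n => (u n).2)
    (fun n => let: And4 a _ _ _ := Hu n in a)
    (fun n => let: And4 _ a _ _ := Hu n in a)
    (fun n => let: And4 _ _ a _ := Hu n in a).
by rewrite sub0r normrN ltNge; have [_ _ _ ->] := Hu n.
Qed.

Lemma bounded_closure D : bounded_set D -> compact (closure D).
Proof.
move=> [M [Mr HM]]; apply: bounded_closed_compact; last exact: closed_closure.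
exists M; split => // r Mr' x cx; apply/ler_addgt0Pr => e e0.
have [y Dy yx] := closure_normr cx e0.
rewrite -[x](subrK y) (le_trans (ler_normD _ _))// addrC lerD//.
  exact: HM.
by rewrite distrC ltW.
Qed.

Lemma open_normr_ball x (e : R) : open [set y : V | `|y - x| < e].
Proof.
rewrite openE => y /= yx; apply/nbhs_ballP.
exists (e - `|y - x|) => /=; first by rewrite subr_gt0.
move=> z; rewrite -ball_normE /= => zy.
by rewrite -(subrKA y) (le_lt_trans (ler_normD _ _))// distrC -ltrBrDr.
Qed.

Lemma bounded_finite_net D (e : R) : bounded_set D -> 0 < e ->
  exists s : seq V, (forall c, c \in s -> D c) /\
    forall x, closure D x -> exists2 c, c \in s & `|x - c| < e.
Proof.
move=> /bounded_closure; rewrite compact_cover => cD e0.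
have [||s sD sc] := cD V D (fun c => [set x | `|x - c| < e]).
- by move=> c _; exact: open_normr_ball.
- move=> x cx; have [y Dy yx] := closure_normr cx e0; exists y => //=.
  by rewrite distrC.
exists (finmap.enum_fset s); split.
  by move=> c cs; apply/set_mem/sD.
by move=> x /sc[c /= cs xc]; exists c.
Qed.

(** Since [e] is the same at all points, [A] is the trace on [Om] of its open [e]-neighbourhood and
    also of the complement of the [e]-neighbourhood of the rest of [Om]: it is relatively open and
    closed. *)
Lemma connected_chain Om (A : set V) (e : R) : connected Om -> 0 < e ->
  A !=set0 -> A `<=` Om ->
  (forall x y, A x -> Om y -> `|y - x| < e -> A y) -> A = Om.
Proof.
move=> cOm e0 A0 AOm HA; apply: cOm => //.
- exists (\bigcup_(x in A) [set y | `|y - x| < e]).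
    by apply: bigcup_open => x _; exact: open_normr_ball.
  apply/seteqP; split => [x Ax|y [Oy [x Ax]]].
    by split; [exact: AOm|exists x => //=; rewrite subrr normr0].
  exact: HA.
- exists (~` \bigcup_(x in Om `\` A) [set y | `|y - x| < e]).
    by apply: open_closedC; apply: bigcup_open => x _; exact: open_normr_ball.
  apply/seteqP; split => [x Ax|y [Oy ny]].
    split; first exact: AOm.
    by move=> [z [Oz nAz] /= xz]; apply: nAz; apply: (HA x) => //; rewrite distrC.
  apply: contrapT => nA; apply: ny; exists y => //=.
  by rewrite subrr normr0.
Qed.

End topology.

(** * The nonlocal operator of a bounded Borel kernel *)

(** [kernel_seq] is the trace of uniform continuity in the first variable that survives a change of
    each [k x] on a null set depending on [x]: two sequences involve only countably many null
    sets. *)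
Record bounded_kernel (R : realType) (N : nat)
    (mu : {measure set 'rV[R]_N -> \bar R}) (Om : set 'rV[R]_N)
    (k : 'rV[R]_N -> 'rV[R]_N -> R) (C : R) : Prop := BoundedKernel {
  kernel_measurable : forall x, Om x -> measurable_fun Om (k x);
  kernel_ge0 : forall x y, Om x -> Om y -> 0 <= k x y;
  kernel_le : forall x y, Om x -> Om y -> k x y <= C;
  kernel_seq : forall x y : nat -> 'rV[R]_N, (forall n, Om (x n)) ->
    (forall n, Om (y n)) -> (forall n, `|x n - y n| < n.+1%:R^-1) ->
    {ae mu, forall z, Om z -> k (x n) z - k (y n) z @[n --> \oo] --> 0} }.

Section nonlocal_operator.
Context (R : realType) (N : nat).
Local Notation V := 'rV[R]_N.
Variables (mu : {measure set V -> \bar R}) (Om : set V) (k : V -> V -> R) (C : R).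
Hypothesis oOm : open Om.
Hypothesis bk : bounded_kernel mu Om k C.

Local Notation L := (Lop mu Om k).
Local Notation int f := (mu.-integrable Om (EFin \o f)).
Implicit Types (f g : V -> R) (x : V).

Let mk := kernel_measurable bk.
Let k_ge0 := kernel_ge0 bk.
Let k_le := kernel_le bk.
Let k_seq := kernel_seq bk.

Let mOm : measurable Om. Proof. exact: open_measurable_rV. Qed.

Let k_norm x y : Om x -> Om y -> `|k x y| <= C.
Proof. by move=> Ox Oy; rewrite ger0_norm ?k_le ?k_ge0. Qed.

Lemma Lop_integrable f x : Om x -> int f -> int (fun y => k x y * f y).
Proof.
move=> Ox fi; apply: (integrableM_bounded mOm (mk Ox) _ fi (M := C)).
by move=> y; exact: k_norm.
Qed.

Lemma LopD f g x : Om x -> int f -> int g ->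
  L (fun y => f y + g y) x = L f x + L g x.
Proof.
move=> Ox fi gi; rewrite /Lop -RintegralD//; try exact: Lop_integrable.
by apply: eq_Rintegral => y _; rewrite mulrDr.
Qed.

Lemma LopB f g x : Om x -> int f -> int g ->
  L (fun y => f y - g y) x = L f x - L g x.
Proof.
move=> Ox fi gi; rewrite /Lop -RintegralB//; try exact: Lop_integrable.
by apply: eq_Rintegral => y _; rewrite mulrBr.
Qed.

Lemma LopZ c f x : Om x -> int f -> L (fun y => c * f y) x = c * L f x.
Proof.
move=> Ox fi; rewrite /Lop -RintegralZl//; try exact: Lop_integrable.
by apply: eq_Rintegral => y _; rewrite mulrCA.
Qed.

Lemma le_Lop f g x : Om x -> int f -> int g ->
  (forall y, Om y -> f y <= g y) -> L f x <= L g x.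
Proof.
move=> Ox fi gi fg; apply: le_Rintegral => //; try exact: Lop_integrable.
by move=> y Oy; rewrite ler_wpM2l ?fg ?k_ge0.
Qed.

Lemma Lop_ge0 f x : Om x -> (forall y, Om y -> 0 <= f y) -> 0 <= L f x.
Proof.
by move=> Ox f0; apply: Rintegral_ge0 => y Oy; rewrite mulr_ge0 ?f0 ?k_ge0.
Qed.

Lemma Lop_le_Rintegral f x : Om x -> int f -> (forall y, Om y -> 0 <= f y) ->
  L f x <= C * \int[mu]_(y in Om) f y.
Proof.
move=> Ox fi f0; rewrite -RintegralZl//; apply: le_Rintegral => //.
- exact: Lop_integrable.
- exact: integrableZR.
- by move=> y Oy; rewrite ler_wpM2r ?f0 ?k_le.
Qed.

Lemma eq_Lop f g x : (forall y, Om y -> f y = g y) -> L f x = L g x.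
Proof. by move=> fg; apply: eq_Rintegral => y /set_mem Oy; rewrite fg. Qed.

(** Dominated convergence with majorant [2 C |f|]. Uniformity is what allows [L f] to be extended
    continuously to the closure. *)
Lemma Lop_unif_continuous f : int f -> unif_continuous_on Om (L f).
Proof.
move=> fi; apply: unif_continuous_seq => x y Ox Oy xy.
have mf := integrable_fun_measurable fi.
have c0 : int (fun z => (C + C) * `|f z|).
  apply: integrableZR => //; apply: le_integrable (fi) => //.
    by apply/measurable_EFinP; exact: measurableT_comp.
  by move=> z Oz /=; rewrite normr_id.
rewrite (_ : (fun n => _) = fun n =>
    \int[mu]_(z in Om) (k (x n) z * f z - k (y n) z * f z)); last first.
  by apply/funext => n; rewrite RintegralB//; exact: Lop_integrable.
rewrite -[X in _ --> X](mul0r (fine (mu Om))) -Rintegral_cst//.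
apply: (Rintegral_dominated_cvg _ _ _ _ c0) => //.
- move=> n; apply: measurable_funB; apply: measurable_funM => //; exact: mk.
- apply: filterS (k_seq Ox Oy xy) => z + Oz => /(_ Oz) h.
  have -> : (fun n => k (x n) z * f z - k (y n) z * f z) =
     (fun n => (k (x n) z - k (y n) z) * f z).
    by apply/funext => n; rewrite mulrBl.
  by rewrite -[X in _ --> X](mul0r (f z)); apply: cvgMl.
- move=> n z Oz; rewrite -mulrBl normrM ler_wpM2r//.
  by rewrite (le_trans (ler_normB _ _))// lerD// k_norm.
Qed.

Lemma Lop_cvg (Om_fin : (mu Om < +oo)%E) (f_ : nat -> V -> R) f (M : R) x : Om x ->
  (forall n, measurable_fun Om (f_ n)) ->
  (forall n y, Om y -> `|f_ n y| <= M) ->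
  (forall y, Om y -> f_ n y @[n --> \oo] --> f y) ->
  L (f_ n) x @[n --> \oo] --> L f x.
Proof.
move=> Ox mf_ f_M cf.
have mf : measurable_fun Om f by exact: measurable_fun_cvg cf.
apply: (@Rintegral_dominated_cvg _ _ _ _ _ _ _ (cst (C * M))) => //.
- by move=> n; apply: measurable_funM => //; exact: mk.
- by apply: measurable_funM => //; exact: mk.
- by apply: aeW => y Oy; apply: cvgMr; exact: cf.
- by apply: (bounded_integrable (M := `|C * M|)).
- by move=> n y Oy; rewrite normrM ler_pM ?f_M ?k_norm.
Qed.

End nonlocal_operator.

(** * Comparison of supersolutions and subsolutions *)

Section principal_eigenvalue.
Context (R : realType) (N : nat).
Local Notation V := 'rV[R]_N.
Variables (mu : {measure set V -> \bar R}) (Om : set V) (k : V -> V -> R) (C : R).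
Hypothesis lmu : is_lebesgue mu.
Hypothesis oOm : open Om.
Hypothesis bOm : bounded_set Om.
Hypothesis Om0 : Om !=set0.
Hypothesis bk : bounded_kernel mu Om k C.
Variable a : V -> R.
Hypothesis ca : C_closure Om a.

Local Notation L := (Lop mu Om k).
Local Notation int f := (mu.-integrable Om (EFin \o f)).
Implicit Types (f g : V -> R) (x : V).

Definition supersolution (l : R) f :=
  [/\ C_closure Om f, (forall x, closure Om x -> 0 < f x) &
      forall x, Om x -> L f x + a x * f x + l * f x <= 0].

Definition subsolution (l : R) f :=
  [/\ (forall x, Om x -> 0 <= f x), (exists x, Om x /\ f x != 0) &
      forall x, Om x -> 0 <= L f x + (a x + l) * f x].

Let mOm : measurable Om. Proof. exact: open_measurable_rV. Qed.
Let Om_fin : (mu Om < +oo)%E. Proof. exact: lebesgue_bounded_lty. Qed.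
Let subOm x : Om x -> closure Om x. Proof. exact: subset_closure. Qed.

Lemma C_closure_bounded f : C_closure Om f ->
  exists2 M : R, 0 < M & forall x, closure Om x -> `|f x| <= M.
Proof.
move=> cf; have cO := bounded_closure bOm.
have O0 : closure Om !=set0 by have [x Ox] := Om0; exists x; exact: subOm.
have [x1 _ h1] := compact_EVT_max O0 cO cf.
have [x2 _ h2] := compact_EVT_min O0 cO cf.
exists (`|f x1| + `|f x2| + 1); first by rewrite ltr_wpDl// addr_ge0.
move=> x cx; have := h1 x (mem_set cx); have := h2 x (mem_set cx).
have := ler_norm (f x1); have := ler_norm (- f x2); rewrite normrN.
have := normr_ge0 (f x1); have := normr_ge0 (f x2).
by rewrite ler_norml; lra.
Qed.

Lemma C_closure_gt0_min f : C_closure Om f -> (forall x, closure Om x -> 0 < f x) ->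
  exists2 m : R, 0 < m & forall x, closure Om x -> m <= f x.
Proof.
move=> cf f0; have cO := bounded_closure bOm.
have O0 : closure Om !=set0 by have [x Ox] := Om0; exists x; exact: subOm.
have [x1 /set_mem cx1 h1] := compact_EVT_min O0 cO cf.
by exists (f x1); [exact: f0|move=> x cx; exact/h1/mem_set].
Qed.

Lemma C_closure_measurable f : C_closure Om f -> measurable_fun Om f.
Proof.
move=> cf; apply: continuous_measurable_within => //.
exact: continuous_subspaceW cf.
Qed.

Lemma C_closure_integrable f : C_closure Om f -> int f.
Proof.
move=> cf; have [M _ fM] := C_closure_bounded cf.
apply: (bounded_integrable mOm Om_fin (C_closure_measurable cf) (M := M)).
by move=> x /subOm; exact: fM.
Qed.

(** The set where [f > M] is open, and nonempty open sets have positive Lebesgue measure. *)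
Lemma within_continuous_ae_le f (M : R) : {within Om, continuous f} ->
  {ae mu, forall x, Om x -> f x <= M} -> forall x, Om x -> f x <= M.
Proof.
move=> cf [Z [mZ Z0 HZ]] x Ox; rewrite leNgt; apply/negP => fx.
have oU : open (Om `&` [set y | M < f y]).
  have oM : open [set t : R | M < t] by exact: open_gt.
  have /continuousP/(_ _ oM) := cf.
  by move=> /open_subspaceP[W oW WD]; rewrite setIC -WD; exact: openI.
have := lebesgue_open_gt0 lmu oU (ex_intro _ x (conj Ox fx)).
rewrite ltNge => /negP; apply; rewrite -Z0; apply: le_measure; rewrite ?inE//.
  exact: open_measurable_rV.
move=> y [Oy fy]; apply: HZ => /= /(_ Oy).
by rewrite leNgt fy.
Qed.

(* With [S] the best constant in [psi <= S phi], the two inequalities bound [psi] by a multiple of [S phi - psi], which improves [S]. *)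
Lemma supersolution_le_subsolution (l l' M : R) (phi psi : V -> R) :
  supersolution l phi -> measurable_fun Om psi ->
  (forall x, Om x -> psi x <= M) -> subsolution l' psi -> l <= l'.
Proof.
move=> [cphi phi0 Hphi] mpsi psiM [psi0 [x0 [Ox0 px0]] Hpsi].
rewrite leNgt; apply/negP => ll'.
have iphi := C_closure_integrable cphi.
have ipsi : int psi.
  apply: (bounded_integrable mOm Om_fin mpsi (M := M)) => x Ox.
  by rewrite ger0_norm ?psi0// psiM.
have [m m0 mphi] := C_closure_gt0_min cphi phi0.
have [Ca Ca0 HCa] : exists2 Ca : R, 0 < Ca & forall x, Om x -> a x + l >= - Ca.
  have [Ma Ma0 HMa] := C_closure_bounded ca.
  exists (Ma + `|l|); first by rewrite ltr_wpDr.
  move=> x /subOm/HMa; have := ler_norm (- l); rewrite normrN.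
  by rewrite ler_norml; lra.
pose Q := [set psi x / phi x | x in Om].
have Q0 : Q !=set0 by exists (psi x0 / phi x0), x0.
have ubQ : has_ubound Q.
  exists (M / m) => _ [x Ox <-].
  have M0 : 0 <= M by apply: le_trans (psi0 _ Ox) (psiM _ Ox).
  rewrite ler_pdivrMr ?phi0//; last exact: subOm.
  rewrite (le_trans (psiM _ Ox))// -mulrA ler_peMr//.
  by rewrite mulrC ler_pdivlMr// mul1r mphi//; exact: subOm.
pose S := sup Q.
have HS : forall x, Om x -> psi x <= S * phi x.
  move=> x Ox; rewrite -ler_pdivrMr ?phi0//; last exact: subOm.
  by apply: ub_le_sup => //; exists x.
have S0 : 0 < S.
  have h := HS _ Ox0; have p0 := phi0 _ (subOm Ox0).
  have : 0 < S * phi x0.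
    by apply: lt_le_trans h; rewrite lt_neqAle eq_sym px0 psi0.
  by rewrite pmulr_lgt0.
(* Combining both inequalities with [L psi <= S L phi] leaves
   [(l - l') psi <= - (a + l) (S phi - psi)], and [- (a + l) <= Ca] while [S phi - psi >= 0]. *)
have key : forall x, Om x -> psi x * (l - l' + Ca) <= Ca * S * phi x.
  move=> x Ox.
  have h1 : L psi x <= S * L phi x.
    rewrite -(LopZ oOm bk)//.
    apply: (le_Lop oOm bk) => //; exact: integrableZR.
  have h2 := Hpsi _ Ox; have h3 := Hphi _ Ox; have h4 := HCa _ Ox.
  have h5 : 0 <= (S * phi x - psi x) * (a x + l + Ca).
    by rewrite mulr_ge0 ?subr_ge0 ?HS//; lra.
  have h6 : S * (L phi x + a x * phi x + l * phi x) <= 0.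
    by rewrite pmulr_rle0.
  nra.
have D0 : 0 < l - l' + Ca by lra.
have : S <= Ca * S / (l - l' + Ca).
  apply: ge_sup => // _ [x Ox <-].
  rewrite ler_pdivlMr// mulrAC ler_pdivrMr ?phi0//; last exact: subOm.
  exact: key.
by rewrite ler_pdivlMr// mulrC ler_pM2r//; lra.
Qed.

Lemma C_c_bounded f : C_c Om f -> exists M : R, forall x, Om x -> `|f x| <= M.
Proof.
move=> [cf [cS SOm]].
have [[x0 [Ox0 fx0]]|no] := pselect (exists x, Om x /\ f x != 0); last first.
  exists 0 => x Ox; rewrite normr_le0; apply/negP => fx; apply: no.
  by exists x; split => //; exact/negP.
have S0 : closure [set x | Om x /\ f x != 0] !=set0.
  by exists x0; exact: subset_closure.
have cfS : {within closure [set x | Om x /\ f x != 0], continuous f}.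
  exact: continuous_subspaceW cf.
have [x1 _ h1] := compact_EVT_max S0 cS cfS.
have [x2 _ h2] := compact_EVT_min S0 cS cfS.
exists (`|f x1| + `|f x2|) => x Ox.
have [->|fx] := eqVneq (f x) 0; first by rewrite normr0 addr_ge0.
have xS : x \in closure [set x | Om x /\ f x != 0].
  by apply/mem_set/subset_closure.
have := h1 _ xS; have := h2 _ xS.
have := ler_norm (f x1); have := ler_norm (- f x2); rewrite normrN.
have := normr_ge0 (f x1); have := normr_ge0 (f x2).
by rewrite ler_norml; lra.
Qed.

(** Since [L phi >= 0], the zeroth-order part must be nonpositive. This bounds the levels of
    supersolutions from above. *)
Lemma supersolution_opp_ge0 l phi x : supersolution l phi -> Om x -> a x + l <= 0.
Proof.
move=> [cphi phi0 Hphi] Ox; have := Hphi _ Ox.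
have Lp : 0 <= L phi x by apply: (Lop_ge0 bk) => // y /subOm /phi0 /ltW.
have p0 := phi0 _ (subOm Ox) => H.
by rewrite -(pmulr_lle0 _ p0); lra.
Qed.

Lemma exists_supersolution : exists l, supersolution l (cst 1).
Proof.
have [Ma Ma0 HMa] := C_closure_bounded ca.
have i1 : int (cst 1).
  by apply: C_closure_integrable => x; exact: cst_continuous.
exists (- (Ma + `|C| * fine (mu Om))); split => //.
  by move=> x; exact: cst_continuous.
move=> x Ox; rewrite !mulr1.
have := Lop_le_Rintegral oOm bk Ox i1 (fun _ _ => ler01).
rewrite Rintegral_cst// mul1r => H1.
have H2 : C * fine (mu Om) <= `|C| * fine (mu Om).
  by rewrite ler_wpM2r ?ler_norm// fine_ge0.
have := HMa _ (subOm Ox); rewrite ler_norml => /andP[_ H3]; lra.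
Qed.

Lemma C_closure_ge f (c : R) : C_closure Om f -> (forall x, Om x -> c <= f x) ->
  forall x, closure Om x -> c <= f x.
Proof.
move=> /within_continuous_normP cf fc x cx; apply/ler_addgt0Pr => e e0.
have [d d0 Hd] := cf _ cx _ e0.
have [y Oy yx] := closure_normr cx d0.
have := Hd _ (subOm Oy) yx; have := fc _ Oy.
by rewrite ltr_norml; lra.
Qed.

(** * Solving [L u + (a + l) u = -1] below the critical level *)

Section resolvent.
Variables (l s e : R) (phi : V -> R).
Hypothesis s0 : 0 < s.
Hypothesis e0 : 0 < e.
Hypothesis Hphi : supersolution (l + s) phi.
Hypothesis ale : forall x, Om x -> a x + l <= - e.

Let b x := - (a x + l).

Let b_ge x : Om x -> e <= b x.
Proof. by move=> /ale; rewrite /b; lra. Qed.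

Fixpoint resolvent_iter (n : nat) : V -> R :=
  if n is n'.+1 then fun x => (1 + L (resolvent_iter n') x) / b x else cst 0.
Local Notation u_ := resolvent_iter.

(** The level of [phi] exceeds [l] by [s], so this bound gives [L (c phi) + (a + l) c phi <= - c s
    phi <= -1]: the function [c phi] is an upper barrier for the iterates. *)
Let c0 : exists2 c : R, 0 < c & forall x, closure Om x -> 1 <= c * s * phi x.
Proof.
have [cphi phi0 _] := Hphi.
have [m m0 Hm] := C_closure_gt0_min cphi phi0.
exists (s * m)^-1; first by rewrite invr_gt0 mulr_gt0.
move=> x /Hm mx; rewrite invfM (mulrC s^-1) mulfVK ?gt_eqF// mulrC.
by rewrite ler_pdivlMr// mul1r.
Qed.

Let cbV : {within Om, continuous (fun x => (b x)^-1)}.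
Proof.
have /subspace_continuousP cb : {within Om, continuous a}.
  exact: continuous_subspaceW ca.
apply/subspace_continuousP => x Ox; apply: cvgV.
  by rewrite gt_eqF// (lt_le_trans e0)// b_ge.
by apply: cvgN; apply: cvgD; [exact: cb|exact: cvg_cst].
Qed.

Let resolvent_iter_prop : exists M, forall n,
  [/\ measurable_fun Om (u_ n), (forall x, Om x -> 0 <= u_ n x <= M) &
      forall x, Om x -> u_ n x <= u_ n.+1 x].
Proof.
have [c c_gt0 Hc] := c0.
have [cphi phi0 Hp] := Hphi.
have iphi := C_closure_integrable cphi.
have [M M0 HM] := C_closure_bounded cphi.
have icphi : int (fun x => c * phi x) by exact: integrableZR.
have [H1 H2] : (forall n, measurable_fun Om (u_ n) /\
    forall x, Om x -> 0 <= u_ n x <= c * phi x) /\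
    forall n x, Om x -> u_ n x <= u_ n.+1 x.
  have iu (f : V -> R) : measurable_fun Om f -> (forall x, Om x -> 0 <= f x <= c * phi x) ->
      int f.
    move=> mf fc; apply: (le_integrableR mOm mf _ icphi) => x Ox.
    by have /andP[f0 ?] := fc _ Ox; rewrite ger0_norm.
  have H1 n : measurable_fun Om (u_ n) /\
      forall x, Om x -> 0 <= u_ n x <= c * phi x.
    elim: n => [|n [mu_n Hn]] /=.
      by split=> // x /subOm/phi0 p0; rewrite lexx mulr_ge0 ?ltW.
    have ui := iu _ mu_n Hn; split.
      apply: measurable_funM.
        apply: measurable_funD => //; apply: continuous_measurable_within => //.
        apply: unif_continuous_within.
        exact: (Lop_unif_continuous oOm bk).
      exact: continuous_measurable_within.
    move=> x Ox; have b0 : 0 < b x by apply: lt_le_trans (b_ge Ox).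
    have L0 : 0 <= L (u_ n) x.
      by apply: (Lop_ge0 bk) => // y /Hn/andP[].
    apply/andP; split; first by rewrite divr_ge0 ?addr_ge0// ltW.
    rewrite ler_pdivrMr//.
    have h1 : L (u_ n) x <= c * L phi x.
      rewrite -(LopZ oOm bk)//.
      by apply: (le_Lop oOm bk) => // y /Hn/andP[].
    have h2 := Hp _ Ox; have h3 := Hc _ (subOm Ox).
    have h4 : c * (L phi x + a x * phi x + (l + s) * phi x) <= 0.
      by rewrite pmulr_rle0.
    by rewrite /b; nra.
  split=> // n; elim: n => [|n IH] x Ox.
    by have [_ /(_ _ Ox)/andP[]] := H1 1%N.
  have b0 : 0 < b x by apply: lt_le_trans (b_ge Ox).
  rewrite /= ler_pM2r ?invr_gt0// lerD2l.
  have [m1 g1] := H1 n; have [m2 g2] := H1 n.+1.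
  by apply: (le_Lop oOm bk) => //; exact: iu.
exists (c * M) => n; have [m1 g1] := H1 n; split => // x Ox; last exact: H2.
have /andP[-> /=] := g1 _ Ox; move=> /le_trans; apply.
rewrite ler_pM2l// (le_trans (ler_norm _))// HM//; exact: subOm.
Qed.

Lemma exists_resolvent : exists u : V -> R, [/\ C_closure Om u,
  (forall x, closure Om x -> 0 < u x) &
  forall x, Om x -> L u x + a x * u x + l * u x = -1].
Proof.
have [M HM] := resolvent_iter_prop.
pose w x := lim (u_ n x @[n --> \oo]).
have M0 : 0 <= M.
  by have [x Ox] := Om0; have [_ /(_ _ Ox)/andP[h1 h2] _] := HM 0%N; exact: le_trans h1 h2.
have u_cvg : forall x, Om x -> u_ n x @[n --> \oo] --> w x.
  move=> x Ox; apply: nondecreasing_is_cvgn.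
    by apply/nondecreasing_seqP => n; have [_ _ h] := HM n; exact: h.
  by exists M => _ [n _ <-]; have [_ /(_ _ Ox)/andP[? ?] _] := HM n.
have mu_ n : measurable_fun Om (u_ n) by have [? _ _] := HM n.
have mw : measurable_fun Om w by exact: measurable_fun_cvg u_cvg.
have u_M n y : Om y -> `|u_ n y| <= M.
  by move=> Oy; have [_ /(_ _ Oy)/andP[u0 uM] _] := HM n; rewrite ger0_norm.
have w_ge0 : forall y, Om y -> 0 <= w y.
  move=> y Oy; apply: limr_ge; first by apply/cvg_ex; exists (w y); exact: u_cvg.
  by apply: nearW => n; have [_ /(_ _ Oy)/andP[? ?] _] := HM n.
have w_M : forall y, Om y -> `|w y| <= M.
  move=> y Oy; rewrite ger0_norm ?w_ge0//.
  apply: limr_le; first by apply/cvg_ex; exists (w y); exact: u_cvg.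
  by apply: nearW => n; have [_ /(_ _ Oy)/andP[? ?] _] := HM n.
have wi : int w by exact: (bounded_integrable mOm Om_fin mw w_M).
have wE : forall x, Om x -> w x = (1 + L w x) / b x.
  move=> x Ox; apply: (@cvg_unique _ _ (u_ n.+1 x @[n --> \oo])) => //.
    by have := u_cvg _ Ox; rewrite -cvg_shiftS.
  apply: cvgMl; apply: cvgD; first exact: cvg_cst.
  exact: (Lop_cvg oOm bk Om_fin Ox mu_ u_M u_cvg).
(* The pointwise limit [w] is so far only measurable on [Om]. As [L w] extends continuously to the
   closure, the fixed point equation itself supplies the continuous representative [(1 + g) / b]. *)
have [g [cg gE g_ge]] :=
  unif_continuous_extension (Lop_unif_continuous oOm bk wi).
have g0 : forall x, closure Om x -> 0 <= g x.
  by apply: g_ge => x Ox; exact: (Lop_ge0 bk).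
have cb : C_closure Om b.
  apply/subspace_continuousP => x cx; have /subspace_continuousP ca' := ca.
  by apply: cvgN; apply: cvgD; [exact: ca'|exact: cvg_cst].
have be : forall x, closure Om x -> e <= b x by exact: C_closure_ge.
have b0 : forall x, closure Om x -> 0 < b x.
  by move=> x /be; exact: lt_le_trans.
have uw : forall x, Om x -> (1 + g x) / b x = w x.
  by move=> x Ox; rewrite wE// gE.
exists (fun x => (1 + g x) / b x); split.
- apply/subspace_continuousP => x cx; apply: cvgM.
    apply: cvgD; first exact: cvg_cst.
    by have /subspace_continuousP := cg; exact.
  apply: cvgV; first by rewrite gt_eqF// b0.
  by have /subspace_continuousP := cb; exact.
- by move=> x cx; rewrite divr_gt0 ?b0// ltr_pwDl// g0.
- move=> x Ox; rewrite (eq_Lop mu k x uw) uw//.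
  have bx := b0 _ (subOm Ox).
  have : b x * w x = 1 + L w x by rewrite wE// mulrC divfK// gt_eqF.
  by rewrite /b; lra.
Qed.

End resolvent.

Lemma approx_eigenfunction (Ls e d : R) :
  (forall l phi, supersolution l phi -> l <= Ls) ->
  (forall d' : R, 0 < d' -> exists l phi, supersolution l phi /\ Ls - d' < l) ->
  0 < e -> 0 < d -> (forall x, Om x -> a x + Ls <= - e) ->
  exists v : V -> R, exists t : R,
    [/\ C_closure Om v, (forall x, closure Om x -> 0 < v x <= 1), 0 < t <= d,
     (forall x, Om x -> L v x + (a x + (Ls - d)) * v x = - t) &
     exists2 x, Om x & 1 / 2 <= v x].
Proof.
move=> ub lub e0 d0 ae.
have [l' [phi [Hphi ll']]] := lub _ d0.
pose l := Ls - d; pose s := l' - l.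
have s0 : 0 < s by rewrite /s /l; lra.
have Hphi' : supersolution (l + s) phi.
  by rewrite (_ : l + s = l')// /s; lra.
have ae' : forall x, Om x -> a x + l <= - e.
  by move=> x /ae; rewrite /l; lra.
have [u [cu u0 uE]] := exists_resolvent s0 e0 Hphi' ae'.
have O0 : closure Om !=set0 by have [x Ox] := Om0; exists x; exact: subOm.
have [xm /set_mem cxm hm] := compact_EVT_max O0 (bounded_closure bOm) cu.
have uM : forall x, closure Om x -> u x <= u xm by move=> x cx; exact/hm/mem_set.
have M0 := u0 _ cxm.
have iu := C_closure_integrable cu.
(* With [M = u xm], raising the level by [1 / M] adds [u / M <= 1] to the right-hand side [-1], so
   [u] is a supersolution at [l + 1 / M], which cannot exceed [Ls = l + d]. *)
have Md : (u xm)^-1 <= d.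
  have : supersolution (l + (u xm)^-1) u.
    split => // x Ox; have := uE _ Ox.
    have : u x * (u xm)^-1 <= 1 by rewrite ler_pdivrMr// mul1r uM//; exact: subOm.
    by lra.
  by move=> /ub; rewrite /l; lra.
exists (fun x => (u xm)^-1 * u x), (u xm)^-1; split.
- apply/subspace_continuousP => x cx; apply: cvgM; first exact: cvg_cst.
  by have /subspace_continuousP := cu; exact.
- move=> x cx; rewrite mulr_gt0 ?invr_gt0 ?u0//=.
  by rewrite mulrC ler_pdivrMr// mul1r uM.
- by rewrite invr_gt0 M0.
- move=> x Ox; rewrite (LopZ oOm bk)//.
  have := uE _ Ox; rewrite -/l => H.
  by rewrite -[RHS]mulrN1 -H; ring.
(* The maximum over the closure may lie on the boundary; continuity gives a point of [Om] with at
   least half the maximal value. *)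
- have M20 : 0 < u xm / 2 by rewrite divr_gt0.
  have /within_continuous_normP := cu => /(_ _ cxm _ M20)[r r0 Hr].
  have [y Oy yx] := closure_normr cxm r0; exists y => //.
  have := Hr _ (subOm Oy) yx; rewrite ltr_norml => /andP[h _].
  by rewrite [leRHS]mulrC ler_pdivlMr//; lra.
Qed.


End principal_eigenvalue.

(** * A Harnack inequality for functions dominating their local averages *)

Section harnack.
Context (R : realType) (N : nat).
Local Notation V := 'rV[R]_N.
Variables (mu : {measure set V -> \bar R}) (Om : set V).
Hypothesis lmu : is_lebesgue mu.
Hypothesis oOm : open Om.
Hypothesis bOm : bounded_set Om.
Hypothesis cOm : connected Om.
Local Notation int f := (mu.-integrable Om (EFin \o f)).

Let mOm : measurable Om. Proof. exact: open_measurable_rV. Qed.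
Let Om_fin : (mu Om < +oo)%E. Proof. exact: lebesgue_bounded_lty. Qed.

Definition local_integral (r : R) (v : V -> R) (x : V) : R :=
  \int[mu]_(y in Om) (\1_[set z | `|z - x| < r] y * v y).

Lemma measurable_indic_ball (x : V) (r : R) :
  measurable_fun Om (\1_[set z | `|z - x| < r] : V -> R).
Proof. by apply: measurable_indic; exact: measurable_normr_ball. Qed.

Lemma local_integrable (r : R) v x : int v ->
  int (fun y => \1_[set z | `|z - x| < r] y * v y).
Proof.
move=> vi; apply: (integrableM_bounded mOm (measurable_indic_ball _ _) _ vi (M := 1)).
by move=> y _; rewrite indicE normr_nat lern1 leq_b1.
Qed.

Lemma local_integral_ge0 r v x : (forall x, Om x -> 0 <= v x) ->
  0 <= local_integral r v x.
Proof.
by move=> v0; apply: Rintegral_ge0 => y Oy; rewrite mulr_ge0 ?v0// indicE.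
Qed.

Lemma le_local_integral r r' v x x' : int v -> (forall x, Om x -> 0 <= v x) ->
  (forall y, `|y - x| < r -> `|y - x'| < r') ->
  local_integral r v x <= local_integral r' v x'.
Proof.
move=> vi v0 H; apply: le_Rintegral => //; try exact: local_integrable.
move=> y Oy; rewrite ler_wpM2r ?v0// !indicE ler_nat.
case: (boolP (y \in [set z | `|z - x| < r])) => // /set_mem /= h.
by rewrite mem_set//; exact: H.
Qed.

Lemma Rintegral_indicM (A : set V) (c : R) : measurable A ->
  \int[mu]_(y in Om) (c * \1_A y) = c * fine (mu (A `&` Om)).
Proof.
move=> mA; rewrite RintegralZl//; last first.
  apply: (bounded_integrable mOm Om_fin (M := 1)) => [|y _].
    exact: measurable_indic.
  by rewrite indicE normr_nat lern1 leq_b1.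
by congr (_ * _); rewrite /Rintegral integral_indic.
Qed.

Lemma seq_uniform_gt0 (I : eqType) (s : seq I) (P : I -> R -> Prop) :
  (forall i c c', P i c -> 0 < c' <= c -> P i c') ->
  (forall i, i \in s -> exists2 c, 0 < c & P i c) ->
  exists2 c, 0 < c & forall i, i \in s -> P i c.
Proof.
move=> down; elim: s => [|i s IH] H; first by exists 1.
have [|c c0 Hc] := IH; first by move=> j js; apply: H; rewrite in_cons js orbT.
have [c' c'0 Hc'] := H i (mem_head _ _).
have m0 : 0 < Num.min c c' by rewrite lt_min c0.
exists (Num.min c c') => // j; rewrite in_cons => /orP[/eqP->|js].
  by apply: down Hc' _; rewrite m0 ge_min lexx orbT.
by apply: down (Hc _ js) _; rewrite m0 ge_min lexx.
Qed.

Variables (kap rho : R).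
Hypothesis kap0 : 0 < kap.
Hypothesis rho0 : 0 < rho.

(** This isolates what the Harnack inequality may use about [v], so that its constant depends on
    [Om], [kap] and [rho] alone. *)
Definition locally_averaged (v : V -> R) := [/\ int v,
  (forall x, Om x -> 0 <= v x) &
  forall x, Om x -> kap * local_integral rho v x <= v x].

Local Notation J := (local_integral (rho / 2)).

(** The points comparable with [x0], with a constant common to all [v], are stable under steps
    shorter than [rho / 2]; by connectedness they fill [Om]. *)
Lemma local_integral_compare x0 x : Om x0 -> Om x ->
  exists2 c, 0 < c & forall v, locally_averaged v -> c * J v x0 <= J v x.
Proof.
move=> Ox0 Ox.
pose A := [set x | Om x /\
  exists2 c, 0 < c & forall v, locally_averaged v -> c * J v x0 <= J v x].
suff AE : A = Om by move: Ox; rewrite -{1}AE => -[].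
have r20 : 0 < rho / 2 by rewrite divr_gt0.
apply: (connected_chain cOm r20).
- by exists x0; split => //; exists 1 => // v _; rewrite mul1r.
- by move=> y [].
move=> {Ox}x y [Ox [c c0 Hc]] Oy yx; split => //.
pose B z : set V := [set t | `|t - z| < rho / 2].
(* For [z] in [G] the [rho]-ball of [z] contains the [rho / 2]-ball of [x], so [v z >= kap * J v x].
   Integrating over [G], which lies in the [rho / 2]-ball of [y], yields the extra factor
   [kap * mu G]. *)
pose G := Om `&` (B x `&` B y).
have oG : open G by apply: openI => //; apply: openI; exact: open_normr_ball.
have Gy : G y by split => //; split => //; rewrite /B /= subrr normr0.
have mG : measurable G by exact: open_measurable_rV.
have muG : 0 < fine (mu G).
  rewrite fine_gt0// (lebesgue_open_gt0 lmu oG)/=; last by exists y.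
  by apply: le_lt_trans Om_fin; apply: le_measure; rewrite ?inE// => z [].
exists (kap * fine (mu G) * c); first by rewrite !mulr_gt0.
move=> v Hv; have [vi v0 Hav] := Hv.
apply: (@le_trans _ _ (kap * fine (mu G) * J v x)).
  by rewrite -(mulrA _ c) ler_pM2l ?Hc// mulr_gt0.
have -> : kap * fine (mu G) * J v x =
    \int[mu]_(z in Om) (kap * J v x * \1_G z).
  rewrite Rintegral_indicM// mulrAC; congr (_ * fine (mu _)).
  by apply/seteqP; split => [z Gz|z []//]; split => //; case: Gz.
have KJ : 0 <= kap * J v x by rewrite mulr_ge0 ?(ltW kap0) ?local_integral_ge0.
apply: le_Rintegral => //.
- apply: (bounded_integrable mOm Om_fin (M := kap * J v x)) => [|z _].
    by apply: measurable_funM => //; exact: measurable_indic.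
  by rewrite normrM (ger0_norm KJ) indicE normr_nat ler_piMr ?lern1 ?leq_b1.
- exact: local_integrable.
move=> z Oz; rewrite !indicE.
case: (boolP (z \in G)) => [/set_mem[_ [zx zy]]|_]; last first.
  by rewrite mulr0 mulr_ge0// v0.
rewrite mem_set// mulr1 mul1r; apply: le_trans (Hav _ Oz).
rewrite ler_pM2l//; apply: le_local_integral => // t tx.
rewrite -(subrKA x) (le_lt_trans (ler_normD _ _))// [X in _ + X]distrC.
by rewrite [rho]splitr ltrD.
Qed.

(** Take a finite [rho / 2]-net. The value [v x] controls [J v] at a net point near [x], hence, by
    comparison, at every net point, and the sum of these local integrals dominates the full
    integral. *)
Lemma harnack : exists2 m, 0 < m & forall v, locally_averaged v ->
  forall x, Om x -> m * \int[mu]_(y in Om) v y <= v x.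
Proof.
have r20 : 0 < rho / 2 by rewrite divr_gt0.
have [s [sO sc]] := bounded_finite_net bOm r20.
have [c c0 Hc] : exists2 c, 0 < c & forall i, i \in s -> forall j, j \in s ->
    forall v, locally_averaged v -> c * J v i <= J v j.
  apply: seq_uniform_gt0.
    move=> i c c' H /andP[c'0 cc'] j js v Hv; apply: le_trans (H _ js _ Hv).
    by rewrite ler_wpM2r//; apply: local_integral_ge0; case: Hv.
  move=> i is_; apply: seq_uniform_gt0.
    move=> j c c' H /andP[c'0 cc'] v Hv; apply: le_trans (H _ Hv).
    by rewrite ler_wpM2r//; apply: local_integral_ge0; case: Hv.
  by move=> j js; apply: local_integral_compare; exact: sO.
(* Adding one bound per net point costs a factor [size s]; the successor makes the quotient positive
   for any [s]. *)
exists (kap * c / (size s).+1%:R); first by rewrite divr_gt0// mulr_gt0.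
move=> v Hv x Ox; have [vi v0 Hav] := Hv.
have [j js xj] := sc _ (subset_closure Ox).
have hJ i : i \in s -> kap * c * J v i <= v x.
  move=> si; apply: le_trans (Hav _ Ox); rewrite -mulrA ler_pM2l//.
  apply: le_trans (Hc _ si _ js _ Hv) _; apply: le_local_integral => // t tj.
  rewrite -(subrKA j) (le_lt_trans (ler_normD _ _))// [X in _ + X]distrC.
  by rewrite [rho]splitr ltrD.
have hsum : \int[mu]_(y in Om) v y <= \sum_(i <- s) J v i.
  have [i1 <-] := @integrable_sum_seq _ _ _ mu V s Om
    (fun i y => \1_[set z | `|z - i| < rho / 2] y * v y) mOm
    (fun i _ => local_integrable (rho / 2) i vi).
  apply: le_Rintegral => // y Oy; have [i si yi] := sc _ (subset_closure Oy).
  rewrite (big_rem i)//= indicE mem_set// mul1r lerDl.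
  by apply: sumr_ge0 => t _; rewrite mulr_ge0 ?v0// indicE.
rewrite mulrAC ler_pdivrMr//.
apply: le_trans (_ : kap * c * \sum_(i <- s) J v i <= _).
  by rewrite ler_pM2l// mulr_gt0.
rewrite mulr_sumr (@le_trans _ _ (\sum_(i <- s) v x))//.
  by rewrite big_seq [leRHS]big_seq; apply: ler_sum => i /hJ.
rewrite big_const_seq count_predT iter_addr_0 -[leLHS]mulr_natr ler_wpM2l ?v0//.
by rewrite ler_nat.
Qed.

End harnack.

(** * Lipschitz cutoffs exhausting a bounded open set *)

Section cutoff.
Context (R : realType) (N : nat).
Local Notation V := 'rV[R]_N.
Variables (mu : {measure set V -> \bar R}) (Om : set V).
Hypothesis lmu : is_lebesgue mu.
Hypothesis oOm : open Om.
Hypothesis bOm : bounded_set Om.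

Let mOm : measurable Om. Proof. exact: open_measurable_rV. Qed.
Let Om_fin : (mu Om < +oo)%E. Proof. exact: lebesgue_bounded_lty. Qed.

(* Capping at 1 keeps the infimum meaningful when [Om] is the whole space, which happens for [N = 0]. *)
Definition boundary_dist (x : V) : R :=
  inf ([set 1] `|` [set `|x - y| | y in ~` Om]).

Let lb0 x : has_lbound ([set 1] `|` [set `|x - y| | y in ~` Om] : set R).
Proof. by exists 0 => _ [->//|[y _ <-]]. Qed.

Let ne1 x : ([set 1] `|` [set `|x - y| | y in ~` Om] : set R) !=set0.
Proof. by exists 1; left. Qed.

Lemma boundary_dist_lipschitz x y : boundary_dist x <= boundary_dist y + `|x - y|.
Proof.
rewrite -lerBlDr; apply: lb_le_inf => // _ [->|[z nz <-]]; rewrite lerBlDr.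
  by rewrite ler_wpDr//; apply: ge_inf => //; left.
apply: (@le_trans _ _ `|x - z|); first by apply: ge_inf => //; right; exists z.
by rewrite -(subrKA y) addrC ler_normD.
Qed.

Lemma boundary_dist_gt0 x : Om x -> 0 < boundary_dist x.
Proof.
move=> Ox; have [e e0 He] := nbhs_normr_ball (open_nbhs_nbhs (conj oOm Ox)).
have m0 : 0 < Num.min 1 e by rewrite lt_min ltr01.
apply: lt_le_trans m0 _; apply: lb_le_inf => // _ [->|[z nz <-]].
  by rewrite ge_min lexx.
rewrite ge_min; apply/orP; right; rewrite leNgt; apply/negP => xz.
by apply: nz; apply: He; rewrite distrC.
Qed.

Lemma boundary_dist_le0 x : ~ Om x -> boundary_dist x <= 0.
Proof. by move=> nx; apply: ge_inf => //; right; exists x => //; rewrite subrr normr0. Qed.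

(** The shift by [- 1] makes the function vanish as soon as [n * boundary_dist x <= 1], which keeps
    its support away from the complement; it equals 1 once [n * boundary_dist x >= 2]. *)
Definition cutoff (n : nat) (x : V) : R :=
  Num.min 1 (Num.max 0 (n%:R * boundary_dist x - 1)).

Lemma cutoff_itv n x : 0 <= cutoff n x <= 1.
Proof. by rewrite /cutoff ge_min lexx le_min ler01 le_max lexx. Qed.

Lemma cutoff_lipschitz n x y : `|cutoff n x - cutoff n y| <= n%:R * `|x - y|.
Proof.
have h1 := ler_wpM2l (ler0n R n) (boundary_dist_lipschitz x y).
have h2 := ler_wpM2l (ler0n R n) (boundary_dist_lipschitz y x).
rewrite (distrC y) in h2; rewrite mulrDr in h1; rewrite mulrDr in h2.
have h3 : 0 <= n%:R * `|x - y| by rewrite mulr_ge0.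
rewrite /cutoff; move: h1 h2 h3.
move: (n%:R * _) (n%:R * boundary_dist y) (n%:R * `|x - y|) => s t d h1 h2 h3.
have clip (r : R) : [\/ r <= 0 /\ Num.min 1 (Num.max 0 r) = 0,
    0 <= r <= 1 /\ Num.min 1 (Num.max 0 r) = r |
    1 <= r /\ Num.min 1 (Num.max 0 r) = 1].
  have [r0|r0] : r <= 0 \/ 0 < r by case: (lerP r 0); [left|right].
    by apply: Or31; rewrite (max_idPl r0) (min_idPr ler01).
  rewrite (max_idPr (ltW r0)).
  have [r1|r1] : r <= 1 \/ 1 < r by case: (lerP r 1); [left|right].
    by apply: Or32; rewrite (ltW r0) r1 (min_idPr r1).
  by apply: Or33; rewrite (min_idPl (ltW r1)) ltW.
rewrite ler_norml.
by case: (clip (s - 1)) => -[? ->]; case: (clip (t - 1)) => -[? ->]; lra.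
Qed.

Lemma cutoff_unif_continuous n (D : set V) : unif_continuous_on D (cutoff n).
Proof.
move=> e e0; exists (e / n.+1%:R); first by rewrite divr_gt0.
move=> x y _ _ xy; apply: le_lt_trans (cutoff_lipschitz _ _ _) _.
rewrite ltr_pdivlMr// in xy; apply: le_lt_trans xy.
by rewrite mulrC ler_wpM2l// ler_nat.
Qed.

Lemma cutoff_support n (f : V -> R) :
  compact (closure [set x | Om x /\ cutoff n x * f x != 0]) /\
  closure [set x | Om x /\ cutoff n x * f x != 0] `<=` Om.
Proof.
have H x : closure [set x | Om x /\ cutoff n x * f x != 0] x ->
    n%:R^-1 <= boundary_dist x.
  move=> cx; apply/ler_addgt0Pr => e e0.
  have [y [Oy]] := closure_normr cx e0.
  rewrite mulf_eq0 negb_or => /andP[cy _] yx.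
  have : 1 < n%:R * boundary_dist y.
    rewrite ltNge; apply: contra cy => h.
    by rewrite /cutoff (max_idPl _) ?subr_le0// (min_idPr _).
  have [->|n0] := posnP n; first by rewrite mul0r ltr10.
  have n0' : 0 < n%:R :> R by rewrite ltr0n.
  rewrite mulrC -ltr_pdivrMr// div1r => h.
  by have := boundary_dist_lipschitz y x; lra.
split.
  apply: (@subclosed_compact _ _ (closure Om)); first exact: closed_closure.
    exact: bounded_closure.
  by apply: closure_subset => x [].
move=> x cx; apply: contrapT => nx.
have := le_trans (H _ cx) (boundary_dist_le0 nx).
(* For [n = 0] the bound [n^-1 <= boundary_dist x] degenerates because [0^-1 = 0], but then the
   cutoff vanishes identically and the closure has no point. *)
rewrite invr_le0 lern0 => /eqP n0.
have [y [_]] := closure_normr cx ltr01.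
by rewrite n0 /cutoff mul0r sub0r (max_idPl _) ?oppr_le0// (min_idPr _)// mul0r eqxx.
Qed.

Lemma cutoff_cvg x : Om x -> cutoff n x @[n --> \oo] --> (1 : R).
Proof.
move=> /boundary_dist_gt0 d0.
apply: cvg_near_cst; exists (Num.truncn (2 / boundary_dist x)).+1 => // n /= hn.
have : 2 / boundary_dist x < n%:R.
  by apply: lt_le_trans (truncnS_gt _) _; rewrite ler_nat.
rewrite ltr_pdivrMr// => h.
by rewrite /cutoff (min_idPl _)// le_max; apply/orP; right; lra.
Qed.

Lemma exists_cutoff (x1 : V) (e : R) : Om x1 -> 0 < e -> exists n,
  0 < cutoff n x1 /\ \int[mu]_(x in Om) (1 - cutoff n x) < e.
Proof.
move=> Ox1 e0.
have mc n : measurable_fun Om (fun x => 1 - cutoff n x).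
  apply: measurable_funB => //; apply: continuous_measurable_within => //.
  exact/unif_continuous_within/cutoff_unif_continuous.
have i1 : mu.-integrable Om (EFin \o cst (1 : R)).
  by apply: (bounded_integrable mOm Om_fin (M := 1)) => // x _; rewrite normr1.
have : \int[mu]_(x in Om) (1 - cutoff n x) @[n --> \oo] --> (0 : R).
  rewrite -[X in _ --> X](mul0r (fine (mu Om))) -Rintegral_cst//.
  apply: (Rintegral_dominated_cvg _ _ _ _ i1) => //.
    apply: aeW => x Ox; rewrite -[X in _ --> X](subrr 1).
    by apply: cvgB; [exact: cvg_cst|exact: cutoff_cvg].
  move=> n x _; have /andP[h1 h2] := cutoff_itv n x.
  by rewrite ger0_norm ?subr_ge0//= lerBlDr lerDl.
move=> /cvgrPdist_lt/(_ _ e0)[n1 _ H1].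
have /cvgrPdist_lt/(_ _ ltr01)[n2 _ H2] := cutoff_cvg Ox1.
exists (maxn n1 n2); split.
  have := H2 _ (leq_maxr n1 n2) => /=.
  have /andP[h1 h2] := cutoff_itv (maxn n1 n2) x1.
  by rewrite ger0_norm ?subr_ge0//; lra.
have := H1 _ (leq_maxl n1 n2) => /=; rewrite sub0r normrN.
exact: le_lt_trans (ler_norm _).
Qed.

End cutoff.

(** * Compactly supported subsolutions just above the critical level *)

Section compactly_supported_subsolution.
Context (R : realType) (N : nat).
Local Notation V := 'rV[R]_N.
Variables (mu : {measure set V -> \bar R}) (Om : set V) (k : V -> V -> R).
Variables (C c rho : R).
Hypothesis lmu : is_lebesgue mu.
Hypothesis oOm : open Om.
Hypothesis cOm : connected Om.
Hypothesis bOm : bounded_set Om.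
Hypothesis Om0 : Om !=set0.
Hypothesis bk : bounded_kernel mu Om k C.
Hypothesis C0 : 0 < C.
Hypothesis c0 : 0 < c.
Hypothesis rho0 : 0 < rho.
Hypothesis k_ge : forall x y, Om x -> Om y -> `|y - x| < rho -> c <= k x y.
Variable a : V -> R.
Hypothesis ca : C_closure Om a.

Local Notation L := (Lop mu Om k).
Local Notation int f := (mu.-integrable Om (EFin \o f)).

Let mOm : measurable Om. Proof. exact: open_measurable_rV. Qed.
Let Om_fin : (mu Om < +oo)%E. Proof. exact: lebesgue_bounded_lty. Qed.
Let subOm x : Om x -> closure Om x. Proof. exact: subset_closure. Qed.

Lemma bump_subsolution (l : R) : (exists2 x, Om x & 0 < a x + l) ->
  exists phi, C_c Om phi /\ subsolution mu Om k a l phi.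
Proof.
move=> [x0 Ox0 ax0].
(* Cutting off relative to [D] instead of [Om] makes [(a + l) * cutoff] nonnegative everywhere, so
   it adds to the nonnegative [L] term. *)
pose D := Om `&` [set x | 0 < a x + l].
have oD : open D.
  have o1 : open [set t : R | - l < t] by exact: open_gt.
  have caO : {within Om, continuous a} by exact: continuous_subspaceW ca.
  have /continuousP/(_ _ o1) := caO => /open_subspaceP[W oW WD].
  have -> : D = W `&` Om.
    rewrite WD; apply/seteqP; split => x /=.
      move=> [Ox h]; split => //; change (- l < a x).
      by rewrite -subr_gt0 opprK.
    move=> [h Ox]; split => //; have h' : - l < a x := h.
    by rewrite -subr_gt0 opprK in h'.
  exact: openI.
have bD : bounded_set D.
  move: bOm => [M [Mr HM]]; exists M; split => // r Mr' x [Ox _].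
  exact: HM.
have Dx0 : D x0 by [].
have [n [n0 _]] := exists_cutoff lmu oD bD Dx0 ltr01.
have zero x : ~ D x -> cutoff D n x = 0.
  move=> /boundary_dist_le0 h; rewrite /cutoff (max_idPl _) ?(min_idPr _)//.
  by rewrite subr_le0; apply: le_trans ler01; rewrite mulr_ge0_le0.
have SE : [set x | Om x /\ cutoff D n x != 0] =
    [set x | D x /\ cutoff D n x * cst 1 x != 0].
  apply/seteqP; split => x /=; rewrite mulr1 => -[Ox cx]; split => //.
    by apply: contrapT => /zero h; rewrite h eqxx in cx.
  by case: Ox.
have [cS SD] := cutoff_support bD n (cst 1).
exists (cutoff D n); split; first split.
- exact/unif_continuous_within/cutoff_unif_continuous.
- by rewrite SE; split => // x /SD[].
split.
- by move=> x _; have /andP[] := cutoff_itv D n x.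
- by exists x0; rewrite gt_eqF.
move=> x Ox; have cge y : 0 <= cutoff D n y by have /andP[] := cutoff_itv D n y.
apply: addr_ge0; first by apply: (Lop_ge0 bk) => // y _; exact: cge.
have [[_ /= Dx]|/zero ->] := pselect (D x); last by rewrite mulr0.
by rewrite mulr_ge0// ltW.
Qed.

Lemma exists_C_c_subsolution (Ls e : R) :
  (forall l phi, supersolution mu Om k a l phi -> l <= Ls) ->
  (forall d : R, 0 < d ->
     exists l phi, supersolution mu Om k a l phi /\ Ls - d < l) ->
  0 < e -> exists phi, C_c Om phi /\ subsolution mu Om k a (Ls + e) phi.
Proof.
move=> ub lub e0.
have [|nx] := pselect (exists2 x, Om x & 0 < a x + (Ls + e)).
  exact: bump_subsolution.
have ae x : Om x -> a x + Ls <= - e.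
  move=> Ox; rewrite leNgt; apply/negP => h; apply: nx; exists x => //; lra.
have [Ca Ca0 HCa] := C_closure_bounded bOm Om0 ca.
(* [B] bounds [- (a + Ls - d)] for every [d <= 1]; the equation for [v] then gives [L v <= B v],
   hence local averaging with [kap = c / B], whatever [d] is. *)
pose B := Ca + `|Ls| + 1.
have B0 : 0 < B by rewrite ltr_wpDl// addr_ge0// ltW.
have kap0 : 0 < c / B by rewrite divr_gt0.
have [m m0 Hm] := harnack lmu oOm bOm cOm kap0 rho0.
(* A lower bound for the integral of [v]: where [v >= 1 / 2] the equation gives
   [L v >= e / 2 - t >= e / 4], while [L v] is at most [C] times the integral. *)
pose eta := e / 4 / C.
have eta0 : 0 < eta by rewrite !divr_gt0.
pose m1 := m * eta; have m10 : 0 < m1 by rewrite mulr_gt0.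
(* The three bounds serve the choice of [B], the choice of [eta] and the final absorption of errors.
   None of them refers to [v], which is chosen afterwards. *)
pose d := Num.min 1 (Num.min (e / 4) (e * m1 / 2)).
have d0 : 0 < d by rewrite !lt_min ltr01 !divr_gt0// mulr_gt0.
have [d1 d2 d3] : [/\ d <= 1, d <= e / 4 & d <= e * m1 / 2].
  by rewrite /d; split; rewrite !ge_min lexx ?orbT.
have [v [t [cv v01 /andP[t0 td] vE [x1 Ox1 vx1]]]] :=
  approx_eigenfunction lmu oOm bOm Om0 bk ca ub lub e0 d0 ae.
have iv := C_closure_integrable lmu oOm bOm Om0 cv.
have v_ge0 x : Om x -> 0 <= v x by move=> /subOm/v01/andP[/ltW].
have v_le1 x : Om x -> v x <= 1 by move=> /subOm/v01/andP[].
have Lv0 x : Om x -> 0 <= L v x by move=> Ox; exact: (Lop_ge0 bk).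
have Hv : locally_averaged mu Om (c / B) rho v.
  split=> // x Ox; rewrite mulrAC ler_pdivrMr//.
  have h1 : c * local_integral mu Om rho v x <= L v x.
    have ili := local_integrable (mu := mu) oOm rho x iv.
    rewrite /local_integral -RintegralZl//; apply: le_Rintegral => //.
    - exact: integrableZR.
    - exact: (Lop_integrable oOm bk).
    move=> y Oy; rewrite indicE; case: (boolP (y \in _)) => [/set_mem /= yx|_].
      by rewrite mul1r ler_wpM2r ?v_ge0// k_ge.
    by rewrite mul0r mulr0 mulr_ge0 ?v_ge0// (kernel_ge0 bk).
  have h2 := vE _ Ox.
  have h3 : 0 <= v x * (B + (a x + (Ls - d))).
    rewrite mulr_ge0 ?v_ge0//.
    have := HCa _ (subOm Ox); rewrite ler_norml => /andP[h _].
    by have := ler_norm (- Ls); rewrite normrN /B; lra.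
  by lra.
have int_v : eta <= \int[mu]_(y in Om) v y.
  have h1 := Lop_le_Rintegral oOm bk Ox1 iv v_ge0.
  have h2 := vE _ Ox1.
  have h3 : e * v x1 <= - (a x1 + (Ls - d)) * v x1.
    by rewrite ler_wpM2r ?v_ge0//; have := ae _ Ox1; lra.
  have h4 : e * (1 / 2) <= e * v x1 by rewrite ler_pM2l.
  by rewrite /eta ler_pdivrMr// mulrC; lra.
have v_m1 x : Om x -> m1 <= v x.
  move=> Ox; apply: le_trans (Hm _ Hv _ Ox).
  by rewrite ler_pM2l.
(* As [v <= 1], replacing [v] by [h v] lowers [L v] by at most [C] times the integral of [1 - h];
   half of the gain [e * m1] is reserved for this loss. *)
have k'0 : 0 < e * m1 / 2 / C by rewrite !divr_gt0// mulr_gt0.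
have [n [nx1 Hn]] := exists_cutoff lmu oOm bOm Ox1 k'0.
pose h := cutoff Om n.
have h01 x : 0 <= h x <= 1 by exact: cutoff_itv.
have ch : {within Om, continuous h}.
  exact/unif_continuous_within/cutoff_unif_continuous.
have mh : measurable_fun Om h by exact: continuous_measurable_within.
have cvO : {within Om, continuous v} by exact: continuous_subspaceW cv.
have ih : int h.
  by apply: (bounded_integrable mOm Om_fin mh (M := 1)) => x _;
     have /andP[? ?] := h01 x; rewrite ger0_norm.
have i1 : int (cst (1 : R)).
  by apply: (bounded_integrable mOm Om_fin (M := 1)) => // x _; rewrite normr1.
have i1h : int (fun x => 1 - h x) by exact: (integrableBR mOm i1 ih).
have ihv : int (fun x => h x * v x).
  apply: (integrableM_bounded mOm mh _ iv (M := 1)) => x _.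
  by have /andP[? ?] := h01 x; rewrite ger0_norm.
have [cS SO] := cutoff_support bOm n v.
exists (fun x => h x * v x); split; first split => //.
  apply/subspace_continuousP => x Ox; apply: cvgM.
    by have /subspace_continuousP := ch; exact.
  by have /subspace_continuousP := cvO; exact.
split.
- by move=> x Ox; have /andP[? _] := h01 x; rewrite mulr_ge0 ?v_ge0.
- exists x1; split => //; rewrite mulf_neq0 ?gt_eqF//.
  by apply: lt_le_trans vx1; lra.
move=> x Ox; have /andP[h0 h1] := h01 x.
have E1 : L v x - e * m1 / 2 <= L (fun x => h x * v x) x.
  have E2 : L v x - L (fun x => h x * v x) x <= L (fun x => 1 - h x) x.
    rewrite -(LopB oOm bk)//; apply: (le_Lop oOm bk) => //.
      exact: (integrableBR mOm iv ihv).
    move=> y Oy; have /andP[? ?] := h01 y.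
    have -> : v y - h y * v y = (1 - h y) * v y by ring.
    by rewrite ler_piMr ?subr_ge0 ?v_le1.
  have E3 : L (fun x => 1 - h x) x <= C * \int[mu]_(x in Om) (1 - h x).
    apply: (Lop_le_Rintegral oOm bk) => // y _.
    by have /andP[? ?] := h01 y; rewrite subr_ge0.
  have E4 : C * \int[mu]_(x in Om) (1 - h x) <= e * m1 / 2.
    by rewrite mulrC -ler_pdivlMr// ltW.
  by lra.
have E5 := vE _ Ox.
have E6 : e * v x - d <= L v x.
  have : e * v x <= - (a x + (Ls - d)) * v x.
    by rewrite ler_wpM2r ?v_ge0//; have := ae _ Ox; lra.
  by lra.
have E7 : e * m1 <= e * v x by rewrite ler_pM2l// v_m1.
(* Inserting the equation for [v], the target is at least [(1 - h) L v + h ((e + d) v - t) - e m1 /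
   2]. The first two terms form a convex combination of quantities that are both at least
   [e m1 - d], and [d <= e m1 / 2]. *)
have E8 : 0 <= (1 - h x) * (L v x - (e * m1 - d)) by rewrite mulr_ge0//; lra.
have E9 : 0 <= h x * ((e * v x - e * m1) + (d - t) + d * v x + d).
  by rewrite mulr_ge0//; have := mulr_ge0 (ltW d0) (v_ge0 _ Ox); lra.
have E10 : h x * (L v x + (a x + (Ls - d)) * v x) = h x * - t by rewrite E5.
have E11 : 0 <= h x * (d - t) by rewrite mulr_ge0//; lra.
have E12 : 0 <= h x * (d * v x) by rewrite mulr_ge0// mulr_ge0 ?v_ge0// ltW.
have E13 : 0 <= h x * (e * v x - e * m1) by rewrite mulr_ge0//; lra.
by nra.
Qed.

End compactly_supported_subsolution.

(** * Discretising points along a finite net *)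

Section nearest_point.
Context (R : realType) (N : nat).
Local Notation V := 'rV[R]_N.

(* A finitely valued approximation of the identity: replacing [x] by it in [k x y] reduces Fubini to finite sums, so joint measurability of the kernel is never needed. *)
Fixpoint net_point (r : R) (x0 : V) (s : seq V) (x : V) : V :=
  if s is c :: s' then
    if `|x - c| < r then c else net_point r x0 s' x
  else x0.

Lemma net_point_in (D : set V) r x0 s x : D x0 -> (forall c, c \in s -> D c) ->
  D (net_point r x0 s x).
Proof.
move=> Dx0; elim: s => //= c s IH H; case: ifP => _; first exact/H/mem_head.
by apply: IH => c' cs; apply: H; rewrite in_cons cs orbT.
Qed.

Lemma net_point_mem r x0 s x : net_point r x0 s x \in x0 :: s.
Proof.
elim: s => [|c s] /=; first by rewrite mem_head.
case: ifP => _; first by rewrite !in_cons eqxx orbT.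
by rewrite !in_cons => /orP[->//|->]; rewrite !orbT.
Qed.

Lemma net_point_near r x0 s x : (exists2 c, c \in s & `|x - c| < r) ->
  `|x - net_point r x0 s x| < r.
Proof.
move=> [c cs xc]; elim: s cs => //= c' s IH; rewrite in_cons.
case: ifP => // c'x /orP[/eqP cc'|cs]; last exact: IH.
by move: xc; rewrite cc' c'x.
Qed.

Lemma net_point_indic (h : V -> R) r x0 c s x :
  h (net_point r x0 (c :: s) x) =
  \1_[set z | `|z - c| < r] x * h c +
  \1_(~` [set z | `|z - c| < r]) x * h (net_point r x0 s x).
Proof.
rewrite /= !indicE in_setC; case: ifP => xc.
  by rewrite mem_set//= mul1r mul0r addr0.
rewrite memNset /=; last by rewrite /= xc.
by rewrite mul0r add0r mul1r.
Qed.

Lemma measurable_net_point (D : set V) (h : V -> R) r x0 s :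
  measurable_fun D (fun x => h (net_point r x0 s x)).
Proof.
elim: s => [|c s IH]; first by rewrite /=; exact: measurable_cst.
under eq_fun do rewrite net_point_indic.
have mB := measurable_normr_ball c r.
apply: measurable_funD.
  apply: measurable_funM; last exact: measurable_cst.
  by apply: measurable_indic.
apply: measurable_funM => //.
by apply: measurable_indic; exact: measurableC.
Qed.

End nearest_point.

(** * Self-adjointness of the operator for a symmetric kernel *)

Section symmetric_kernel.
Context (R : realType) (N : nat).
Local Notation V := 'rV[R]_N.
Variables (mu : {measure set V -> \bar R}) (Om : set V) (K k : V -> V -> R).
Variable (C : R).
Hypothesis lmu : is_lebesgue mu.
Hypothesis oOm : open Om.
Hypothesis bOm : bounded_set Om.
Hypothesis Om0 : Om !=set0.
Hypothesis bk : bounded_kernel mu Om k C.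
Hypothesis Kk : forall x, Om x -> {ae mu, forall y, Om y -> K x y = k x y}.
Hypothesis Kuc : {ae mu, forall y, Om y -> unif_continuous_on Om (K^~ y)}.
Hypothesis Ksym : forall x y, Om x -> Om y -> K x y = K y x.

Local Notation L := (Lop mu Om k).
Local Notation int f := (mu.-integrable Om (EFin \o f)).

Let mOm : measurable Om. Proof. exact: open_measurable_rV. Qed.
Let Om_fin : (mu Om < +oo)%E. Proof. exact: lebesgue_bounded_lty. Qed.
Let subOm x : Om x -> closure Om x. Proof. exact: subset_closure. Qed.

Lemma Lop_bounded (f : V -> R) : int f -> exists2 M, 0 <= M &
  forall x, Om x -> `|L f x| <= M.
Proof.
move=> fi; have fi' : int (fun x => `|f x|).
  by apply: integrable_norm.
exists (`|C| * \int[mu]_(x in Om) `|f x|).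
  by rewrite mulr_ge0// Rintegral_ge0.
move=> x Ox; have li := Lop_integrable oOm bk Ox fi.
apply: le_trans (le_normr_Rintegral mOm li) _.
rewrite -RintegralZl//; apply: le_Rintegral => //.
- exact: integrable_norm.
- exact: integrableZR.
move=> y Oy; rewrite normrM ler_wpM2r//.
rewrite ger0_norm ?(kernel_ge0 bk)//.
by apply: le_trans (kernel_le bk Ox Oy) (ler_norm _).
Qed.

Lemma integrableM_Lop (f g : V -> R) : int f -> int g ->
  int (fun x => f x * L g x).
Proof.
move=> fi gi; have [M _ HM] := Lop_bounded gi.
have mL : measurable_fun Om (L g).
  apply: continuous_measurable_within => //; apply: unif_continuous_within.
  exact: (Lop_unif_continuous oOm bk).
have := integrableM_bounded mOm mL HM fi; apply: eq_integrable => // x _.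
by rewrite /= mulrC.
Qed.

Lemma net_point_integrable (h : V -> R) (f : V -> R) M r x0 s : int f ->
  Om x0 -> (forall c, c \in s -> Om c) -> (forall x, Om x -> `|h x| <= M) ->
  int (fun x => h (net_point r x0 s x) * f x).
Proof.
move=> fi Ox0 sO hM.
apply: (integrableM_bounded (M := M) mOm _ _ fi).
  exact: measurable_net_point.
by move=> x Ox; apply: hM; exact: net_point_in.
Qed.

Lemma net_point_fubini (f F : V -> R) r x0 s : int f -> int F ->
  Om x0 -> (forall c, c \in s -> Om c) ->
  int (fun y => (\int[mu]_(x in Om) (k (net_point r x0 s x) y * f x)) * F y) /\
  \int[mu]_(y in Om) ((\int[mu]_(x in Om) (k (net_point r x0 s x) y * f x)) * F y)
  = \int[mu]_(x in Om) (L F (net_point r x0 s x) * f x).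
Proof.
move=> + Fi Ox0; elim: s f => [|c s IH] f fi sO.
  rewrite /=; pose I := \int[mu]_(x in Om) f x.
  have E y : \int[mu]_(x in Om) (k x0 y * f x) = I * k x0 y.
    by rewrite RintegralZl// mulrC.
  have iF : int (fun y => I * (k x0 y * F y)).
    by apply: integrableZR => //; exact: (Lop_integrable oOm bk).
  split.
    by apply: eq_integrable iF => // y _ /=; rewrite E mulrA.
  under eq_Rintegral do rewrite E -mulrA.
  rewrite RintegralZl//; last exact: (Lop_integrable oOm bk).
  by rewrite RintegralZl// mulrC.
have Oc : Om c by exact/sO/mem_head.
have sO' c' : c' \in s -> Om c' by move=> cs; apply: sO; rewrite in_cons cs orbT.
set B := [set z : V | `|z - c| < r].
have mB : measurable B by exact: measurable_normr_ball.
pose f1 x := \1_B x * f x; pose f2 x := \1_(~` B) x * f x.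
have i1 : int f1.
  apply: (integrableM_bounded mOm _ _ fi (M := 1)); first exact: measurable_indic.
  by move=> x _; rewrite indicE normr_nat lern1 leq_b1.
have i2 : int f2.
  apply: (integrableM_bounded mOm _ _ fi (M := 1)).
    by apply: measurable_indic; exact: measurableC.
  by move=> x _; rewrite indicE normr_nat lern1 leq_b1.
have [IH1 IH2] := IH f2 i2 sO'.
pose I := \int[mu]_(x in Om) f1 x.
have split_net (h : V -> R) x : h (net_point r x0 (c :: s) x) * f x =
    h c * f1 x + h (net_point r x0 s x) * f2 x.
  by rewrite net_point_indic /f1 /f2 -/B; ring.
have int_net (h : V -> R) M : (forall x, Om x -> `|h x| <= M) ->
    \int[mu]_(x in Om) (h (net_point r x0 (c :: s) x) * f x) =
    h c * I + \int[mu]_(x in Om) (h (net_point r x0 s x) * f2 x).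
  move=> hM; under eq_Rintegral do rewrite split_net.
  rewrite RintegralD//; last 2 first.
  - exact: integrableZR.
  - exact: net_point_integrable hM.
  by rewrite RintegralZl.
have Ey y : Om y -> \int[mu]_(x in Om) (k (net_point r x0 (c :: s) x) y * f x) =
    k c y * I + \int[mu]_(x in Om) (k (net_point r x0 s x) y * f2 x).
  move=> Oy; apply: (int_net (k^~ y) C) => x Ox.
  by rewrite ger0_norm ?(kernel_ge0 bk)// (kernel_le bk).
have iF : int (fun y => I * (k c y * F y)).
  by apply: integrableZR => //; exact: (Lop_integrable oOm bk).
have iS := integrableDR mOm iF IH1.
split.
  apply: eq_integrable iS => // y /set_mem Oy; rewrite /= -/(net_point r x0 (c :: s)).
  by have := Ey _ Oy; rewrite /= => ->; rewrite mulrDl; congr (_ + _)%:E; ring.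
transitivity (\int[mu]_(y in Om) (I * (k c y * F y) +
   (\int[mu]_(x in Om) (k (net_point r x0 s x) y * f2 x)) * F y)).
  by apply: eq_Rintegral => y /set_mem Oy; rewrite Ey// mulrDl; congr (_ + _); ring.
rewrite RintegralD// IH2 RintegralZl//; last exact: (Lop_integrable oOm bk).
have [M _ HM] := Lop_bounded Fi.
by rewrite (int_net _ _ HM) mulrC.
Qed.

(** Let the mesh [1 / (n + 1)] tend to zero in the discretised identity. One side converges because
    [L F] is uniformly continuous, the other because [K] is so in its first variable for almost
    every [y]. *)
Lemma Lop_self_adjoint (f F : V -> R) : int f -> int F ->
  \int[mu]_(x in Om) (L F x * f x) = \int[mu]_(y in Om) (L f y * F y).
Proof.
move=> fi Fi; have [x0 Ox0] := Om0.
have /choice[s Hs] : forall n : nat, exists s : seq V, (forall c, c \in s -> Om c) /\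
    forall x, closure Om x -> exists2 c, c \in s & `|x - c| < n.+1%:R^-1.
  by move=> n; apply: bounded_finite_net.
pose p n := net_point n.+1%:R^-1 x0 (s n).
have Op n x : Om (p n x) by apply: net_point_in => // c cs; exact: (Hs n).1.
have pn n x : Om x -> `|x - p n x| < n.+1%:R^-1.
  by move=> Ox; apply: net_point_near; exact/(Hs n).2/subOm.
have p_cvg (h : V -> R) x : Om x -> unif_continuous_on Om h ->
    h (p n x) @[n --> \oo] --> h x.
  move=> Ox uh; apply/cvgrPdist_lt => e /uh[d d0 Hd].
  have [n0 _ Hn] := near_infty_natSinv_lt (PosNum d0).
  exists n0 => // n nn0; apply: Hd => //.
  by apply: lt_trans (pn _ _ Ox) _; exact: Hn.
(* All the nets together have countably many points, so one null set of [y] works for every [n] and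
   [x]. *)
have aeK : {ae mu, forall y, Om y -> forall n x, k (p n x) y = K (p n x) y}.
  have H n : {ae mu, forall y, Om y -> forall c, c \in x0 :: s n -> k c y = K c y}.
    have: forall c, c \in x0 :: s n -> Om c.
      by move=> c; rewrite in_cons => /orP[/eqP->//|]; exact: (Hs n).1.
    elim: (x0 :: s n) => [_|c t IH tO]; first by apply: aeW.
    have Oc := tO _ (mem_head _ _).
    have tO' c' : c' \in t -> Om c' by move=> ct; apply: tO; rewrite in_cons ct orbT.
    apply: filterS2 (Kk Oc) (IH tO') => y h1 h2 Oy c'; rewrite in_cons.
    by case/orP => [/eqP->|]; [rewrite h1|exact: h2].
  have := ae_foralln H.
  apply: filterS => y Hy Oy n x; apply: Hy => //; exact: net_point_mem.
have lim1 : \int[mu]_(x in Om) (L F (p n x) * f x) @[n --> \oo] -->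
    \int[mu]_(x in Om) (L F x * f x).
  have [M M0 HM] := Lop_bounded Fi.
  have ig : int (fun x => M * `|f x|).
    by apply: integrableZR => //; exact: integrable_norm.
  have uL := Lop_unif_continuous oOm bk Fi.
  have mf := integrable_fun_measurable fi.
  apply: (Rintegral_dominated_cvg _ _ _ _ ig) => //.
  - by move=> n; apply: measurable_funM => //; exact: measurable_net_point.
  - apply: measurable_funM => //; apply: continuous_measurable_within => //.
    exact: unif_continuous_within.
  - by apply: aeW => x Ox; apply: cvgMl; exact: p_cvg.
  - by move=> n x Ox; rewrite normrM ler_wpM2r// HM.
have lim2 : \int[mu]_(y in Om) ((\int[mu]_(x in Om) (k (p n x) y * f x)) * F y)
    @[n --> \oo] --> \int[mu]_(y in Om) (L f y * F y).
  have iaf : int (fun x => `|f x|) by exact: integrable_norm.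
  pose M := `|C| * \int[mu]_(x in Om) `|f x|.
  have ig : int (fun y => M * `|F y|).
    by apply: integrableZR => //; exact: integrable_norm.
  have uL := Lop_unif_continuous oOm bk fi.
  have mf := integrable_fun_measurable fi.
  have mF := integrable_fun_measurable Fi.
  have kM y : Om y -> forall x, Om x -> `|k x y| <= `|C|.
    move=> Oy x Ox; rewrite ger0_norm ?(kernel_ge0 bk)//.
    by apply: le_trans (kernel_le bk Ox Oy) (ler_norm _).
  apply: (Rintegral_dominated_cvg _ _ _ _ ig) => //.
  - move=> n; have [+ _] := @net_point_fubini f F n.+1%:R^-1 x0 (s n) fi Fi Ox0 (Hs n).1.
    exact: integrable_fun_measurable.
  - apply: measurable_funM => //; apply: continuous_measurable_within => //.
    exact: unif_continuous_within.
  (* Symmetry enters here, for [K]: the version [k] need not be symmetric, so the limit is taken as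
     [K x y], turned into [K y x], and only then replaced by [k y x]. *)
  - have aeL : {ae mu, forall y, Om y -> \int[mu]_(x in Om) (K x y * f x) = L f y}.
      apply: aeW => y Oy; rewrite /Lop.
      transitivity (\int[mu]_(x in Om) (K y x * f x)).
        by apply: eq_Rintegral => x /set_mem Ox; rewrite Ksym.
      by apply: Rintegral_ae_eq; apply: filterS (Kk Oy) => x h Ox; rewrite h.
    apply: filterS3 aeK Kuc aeL => y h1 h2 h3 Oy; apply: cvgMl.
    rewrite -h3//.
    have i1 : int (fun x => `|C| * `|f x|) by exact: integrableZR.
    have cK x : Om x -> k (p n x) y * f x @[n --> \oo] --> K x y * f x.
      move=> Ox; apply: cvgMl; under eq_fun do rewrite h1//.
      exact: (p_cvg (K^~ y) _ Ox (h2 Oy)).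
    have mk n : measurable_fun Om (fun x => k (p n x) y * f x).
      apply: measurable_funM => //.
      exact: (measurable_net_point (k^~ y)).
    apply: (Rintegral_dominated_cvg _ _ _ _ i1) => //.
    + exact: measurable_fun_cvg cK.
    + exact: aeW.
    + by move=> n x Ox; rewrite normrM ler_wpM2r// kM.
  - move=> n y Oy; rewrite normrM ler_wpM2r//.
    have i1 : int (fun x => k (p n x) y * f x).
      exact: (@net_point_integrable (k^~ y) f _ n.+1%:R^-1 x0 (s n)
        fi Ox0 (Hs n).1 (kM y Oy)).
    apply: le_trans (le_normr_Rintegral mOm i1) _.
    rewrite /M -RintegralZl//; apply: le_Rintegral => //.
    + exact: integrable_norm.
    + exact: integrableZR.
    + by move=> x Ox; rewrite normrM ler_wpM2r// kM.
have E : (fun n => \int[mu]_(x in Om) (L F (p n x) * f x)) =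
    (fun n => \int[mu]_(y in Om) ((\int[mu]_(x in Om) (k (p n x) y * f x)) * F y)).
  apply/funext => n.
  by have [_ ->] := @net_point_fubini f F n.+1%:R^-1 x0 (s n) fi Fi Ox0 (Hs n).1.
by rewrite E in lim1; apply: cvg_unique lim1 lim2.
Qed.

End symmetric_kernel.

(** * Rayleigh quotient bounds from subsolutions and supersolutions *)

Section variational.
Context (R : realType) (N : nat).
Local Notation V := 'rV[R]_N.
Variables (mu : {measure set V -> \bar R}) (Om : set V) (k : V -> V -> R).
Variable (C : R).
Hypothesis lmu : is_lebesgue mu.
Hypothesis oOm : open Om.
Hypothesis bOm : bounded_set Om.
Hypothesis Om0 : Om !=set0.
Hypothesis bk : bounded_kernel mu Om k C.
Variable a : V -> R.
Hypothesis ca : C_closure Om a.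

Local Notation L := (Lop mu Om k).
Local Notation int f := (mu.-integrable Om (EFin \o f)).

Let mOm : measurable Om. Proof. exact: open_measurable_rV. Qed.
Let Om_fin : (mu Om < +oo)%E. Proof. exact: lebesgue_bounded_lty. Qed.
Let subOm x : Om x -> closure Om x. Proof. exact: subset_closure. Qed.

Lemma square_integrable (psi : V -> R) : measurable_fun Om psi ->
  int (fun x => psi x ^+ 2) -> int psi.
Proof.
move=> mp ip.
have i1 : int (cst (1 : R)).
  by apply: (bounded_integrable mOm Om_fin (M := 1)) => // x _; rewrite normr1.
apply: (le_integrableR mOm mp _ (integrableDR mOm i1 ip)) => x _ /=.
rewrite -(real_normK (num_real (psi x))).
have := sqr_ge0 (`|psi x| - 1); have := normr_ge0 (psi x); nra.
Qed.

Lemma integrable_square_of_mul (psi : V -> R) (h : V -> R) : C_closure Om h ->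
  int (fun x => psi x ^+ 2) -> int (fun x => h x * psi x ^+ 2).
Proof.
move=> ch ip; have [M _ HM] := C_closure_bounded bOm Om0 ch.
apply: (integrableM_bounded mOm (C_closure_measurable oOm ch) _ ip (M := M)).
by move=> x /subOm; exact: HM.
Qed.

Lemma integrableM_Lop_square (psi : V -> R) : measurable_fun Om psi ->
  int (fun x => psi x ^+ 2) -> int (fun x => psi x * L psi x).
Proof.
by move=> mp ip; apply: (integrableM_Lop oOm bk); exact: square_integrable.
Qed.

Lemma Rayleigh_split (psi : V -> R) : measurable_fun Om psi ->
  int (fun x => psi x ^+ 2) ->
  \int[mu]_(x in Om) ((L psi x + a x * psi x) * psi x) =
  \int[mu]_(x in Om) (psi x * L psi x) +
  \int[mu]_(x in Om) (a x * psi x ^+ 2).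
Proof.
move=> mp ip; rewrite -RintegralD//.
- by apply: eq_Rintegral => x _; ring.
- exact: integrableM_Lop_square.
- exact: integrable_square_of_mul.
Qed.

(** Multiply the subsolution inequality by [psi >= 0] and integrate. *)
Lemma subsolution_variational (l : R) (psi : V -> R) :
  measurable_fun Om psi -> int (fun x => psi x ^+ 2) ->
  subsolution mu Om k a l psi ->
  - (\int[mu]_(x in Om) ((L psi x + a x * psi x) * psi x)) <=
  l * \int[mu]_(x in Om) psi x ^+ 2.
Proof.
move=> mp ip [p0 _ Hp].
rewrite Rayleigh_split// lerNl -subr_ge0 opprK -RintegralD//; last 2 first.
- exact: integrableM_Lop_square.
- exact: integrable_square_of_mul.
have i1 := integrableM_Lop_square mp ip.
have i2 := integrable_square_of_mul ca ip.
rewrite -RintegralZl// -RintegralD//; last 2 first.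
- exact: (integrableDR mOm i1 i2).
- exact: integrableZR.
apply: Rintegral_ge0 => x Ox.
have := mulr_ge0 (p0 _ Ox) (Hp _ Ox).
by congr (0 <= _); ring.
Qed.

(* Weighted AM-GM: [psi x * psi y <= (F x * phi y + F y * phi x) / 2] with [F = psi ^+ 2 / phi]; by self-adjointness both terms integrate to [\int F * L phi]. *)
Lemma supersolution_variational (l : R) (phi psi : V -> R) :
  (forall f F, int f -> int F -> \int[mu]_(x in Om) (L F x * f x) =
     \int[mu]_(y in Om) (L f y * F y)) ->
  supersolution mu Om k a l phi -> measurable_fun Om psi ->
  int (fun x => psi x ^+ 2) ->
  l * \int[mu]_(x in Om) psi x ^+ 2 <=
  - (\int[mu]_(x in Om) ((L psi x + a x * psi x) * psi x)).
Proof.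
move=> Lsa [cphi phi0 Hphi] mp ip.
have psii := square_integrable mp ip.
have phii := C_closure_integrable lmu oOm bOm Om0 cphi.
have cphiV : C_closure Om (fun x => (phi x)^-1).
  apply/subspace_continuousP => x cx; apply: cvgV; first by rewrite gt_eqF ?phi0.
  by have /subspace_continuousP := cphi; exact.
pose F x := (phi x)^-1 * psi x ^+ 2.
have Fi : int F by exact: integrable_square_of_mul.
have i1 := integrableM_Lop_square mp ip.
have i2 := integrable_square_of_mul ca ip.
have iFL := integrableM_Lop oOm bk Fi phii.
have iLF := integrableM_Lop oOm bk phii Fi.
have amgm x y : Om x -> Om y ->
    psi x * psi y <= 2^-1 * (F x * phi y + F y * phi x).
  move=> Ox Oy; have px := phi0 _ (subOm Ox); have py := phi0 _ (subOm Oy).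
  rewrite /F [leRHS]mulrC ler_pdivlMr//.
  have -> : (phi x)^-1 * psi x ^+ 2 * phi y + (phi y)^-1 * psi y ^+ 2 * phi x =
     ((psi x * phi y) ^+ 2 + (psi y * phi x) ^+ 2) / (phi x * phi y).
    by field; rewrite !gt_eqF.
  rewrite ler_pdivlMr ?mulr_gt0//.
  have := sqr_ge0 (psi x * phi y - psi y * phi x); nra.
have h1 : \int[mu]_(x in Om) (psi x * L psi x) <=
    \int[mu]_(x in Om) (F x * L phi x).
  have -> : \int[mu]_(x in Om) (F x * L phi x) =
      \int[mu]_(x in Om) (2^-1 * (F x * L phi x + phi x * L F x)).
    have isum := integrableDR mOm iFL iLF.
    rewrite RintegralZl// RintegralD//.
    have -> : \int[mu]_(x in Om) (phi x * L F x) =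
        \int[mu]_(x in Om) (F x * L phi x).
      transitivity (\int[mu]_(x in Om) (L F x * phi x)).
        by apply: eq_Rintegral => x _; rewrite mulrC.
      by rewrite Lsa//; apply: eq_Rintegral => x _; rewrite mulrC.
    by field.
  apply: le_Rintegral => //.
    apply: integrableZR => //; exact: integrableDR.
  move=> x Ox.
  have j1 := integrableZR (psi x) mOm psii.
  have j2 := integrableZR (F x) mOm phii.
  have j3 := integrableZR (phi x) mOm Fi.
  have j4 := integrableDR mOm j2 j3.
  have j5 := integrableZR 2^-1 mOm j4.
  (* With [x] fixed, its factors move inside [L]; the AM-GM inequality in [y] becomes a comparison
     under one application of [L], without a double integral. *)
  rewrite -(LopZ oOm bk _ Ox psii) -(LopZ oOm bk _ Ox phii) -(LopZ oOm bk _ Ox Fi).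
  rewrite -(LopD oOm bk Ox j2 j3) -(LopZ oOm bk _ Ox j4).
  apply: (le_Lop oOm bk Ox j1 j5) => y Oy.
  by rewrite [phi x * _]mulrC; exact: amgm.
(* The supersolution inequality is tested against [F >= 0], and [F * phi = psi ^+ 2]. *)
have h2 : \int[mu]_(x in Om) (F x * L phi x) <=
    \int[mu]_(x in Om) (- 1 * (a x * psi x ^+ 2 + l * psi x ^+ 2)).
  have il : int (fun x => l * psi x ^+ 2) by exact: integrableZR.
  have is_ := integrableDR mOm i2 il.
  apply: le_Rintegral => //; first exact: integrableZR.
  move=> x Ox; have px := phi0 _ (subOm Ox).
  have F0 : 0 <= F x by rewrite mulr_ge0 ?sqr_ge0// invr_ge0 ltW.
  have Fphi : F x * phi x = psi x ^+ 2 by rewrite /F mulrAC mulVf ?mul1r// gt_eqF.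
  have := mulr_ge0 F0 (_ : 0 <= - (L phi x + a x * phi x + l * phi x)).
  rewrite oppr_ge0 => /(_ (Hphi _ Ox)); rewrite -Fphi; nra.
rewrite RintegralZl// in h2; last first.
  by apply: integrableDR => //; exact: integrableZR.
rewrite RintegralD// in h2; last exact: integrableZR.
rewrite RintegralZl// in h2.
rewrite Rayleigh_split//; lra.
Qed.

End variational.

(** * A Borel version of the kernel with the same pointwise bounds *)

Section borel_kernel.
Context (R : realType) (N : nat).
Local Notation V := 'rV[R]_N.
Variables (mu : {measure set V -> \bar R}) (Om : set V) (K : V -> V -> R).
Variables (C c rho : R).
Hypothesis oOm : open Om.
Hypothesis c0 : 0 < c.
Hypothesis cC : c <= C.
Hypothesis mK : forall x, Om x -> lmeasurable_fun mu Om (K x).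
Hypothesis Kuc : {ae mu, forall y, Om y -> unif_continuous_on Om (K^~ y)}.
Hypothesis K_ge0 : forall x y, Om x -> Om y -> 0 <= K x y.
Hypothesis K_le : forall x y, Om x -> Om y -> K x y <= C.
Hypothesis K_ge : forall x y, Om x -> Om y -> `|y - x| < rho -> c <= K x y.

Lemma exists_bounded_kernel : exists k : V -> V -> R,
  [/\ bounded_kernel mu Om k C,
      (forall x y, Om x -> Om y -> `|y - x| < rho -> c <= k x y) &
      forall x, Om x -> {ae mu, forall y, Om y -> K x y = k x y}].
Proof.
have mOm : measurable Om by exact: open_measurable_rV.
have /choice[g Hg] : forall x, exists g : V -> R, Om x ->
    measurable_fun Om g /\ {ae mu, forall y, Om y -> K x y = g y}.
  move=> x; have [Ox|nx] := pselect (Om x); last by exists (cst 0).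
  by have [g [mg Kg]] := mK Ox; exists g.
pose lo x y := c * \1_[set z : V | `|z - x| < rho] y.
have lo_itv x y : 0 <= lo x y <= C.
  rewrite /lo indicE; case: (y \in _); rewrite ?mulr1 ?mulr0.
    by rewrite (ltW c0).
  by rewrite lexx (le_trans (ltW c0)).
(* Clipping makes the kernel bounds hold everywhere and not only almost everywhere. *)
pose k x y := Num.min C (Num.max (lo x y) (g x y)).
have Kk x : Om x -> {ae mu, forall y, Om y -> K x y = k x y}.
  move=> Ox; have [_] := Hg _ Ox; apply: filterS => y + Oy => /(_ Oy) Kg.
  rewrite /k -Kg (max_idPr _) ?(min_idPr _) ?K_le//.
  rewrite /lo indicE; case: (boolP (y \in _)) => [/set_mem yx|_].
    by rewrite mulr1 K_ge.
  by rewrite mulr0 K_ge0.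
have mk x : Om x -> measurable_fun Om (k x).
  move=> Ox; have [mg _] := Hg _ Ox.
  have -> : k x = fun y => - ((cst (- C)) \max (fun y => - (lo x \max g x) y)) y.
    by apply/funext => y; rewrite /k /= oppr_max !opprK.
  apply: measurableT_comp => //; apply: measurable_maxr => //.
  apply: measurableT_comp => //; apply: measurable_maxr => //.
  apply: measurable_funM => //; apply: measurable_indic.
  exact: measurable_normr_ball.
exists k; split => //; first split => //.
- move=> x y _ _; have /andP[l1 l2] := lo_itv x y.
  by rewrite le_min le_max l1 (le_trans l1 l2).
- by move=> x y _ _; rewrite ge_min lexx.
- move=> x y Ox Oy xy.
  (* Off the countable union of the null sets attached to the points [x n] and [y n], differences of
     [k] along the sequences equal those of [K]. *)
  have H1 := ae_foralln (fun n => Kk _ (Ox n)).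
  have H2 := ae_foralln (fun n => Kk _ (Oy n)).
  apply: filterS3 H1 H2 Kuc => z h1 h2 h3 Oz.
  rewrite (_ : (fun n => _) = fun n => K (x n) z - K (y n) z); last first.
    by apply/funext => n; rewrite h1// h2.
  apply/cvgrPdist_lt => e e0; have [d d0 Hd] := h3 Oz e e0.
  have [n0 _ Hn] := near_infty_natSinv_lt (PosNum d0).
  exists n0 => // n nn0; rewrite sub0r normrN; apply: Hd => //.
  by apply: lt_trans (xy n) _; exact: Hn.
- move=> x y Ox Oy yx; rewrite /k le_min cC le_max /lo indicE mem_set//.
  by rewrite mulr1 lexx.
Qed.

End borel_kernel.

(** * Passage from [k] back to [K] and comparison of the four quantities *)

Theorem theorem1p1 (R : realType) (N : nat)
  (mu : {measure set 'rV[R]_N -> \bar R}) (Om : set 'rV[R]_N)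
  (a : 'rV[R]_N -> R) (K : 'rV[R]_N -> 'rV[R]_N -> R)
  (r0 r1 C0 c0 : R) :
  is_lebesgue mu ->
  open Om -> connected Om -> Om !=set0 -> bounded_set Om ->
  C_closure Om a -> Linfty mu Om a ->
  (forall x y, Om x -> Om y -> 0 <= K x y) ->
  (forall x, Om x -> lmeasurable_fun mu Om (K x)) ->
  {ae mu, forall y, Om y ->
     forall e : R, 0 < e -> exists2 d : R, 0 < d &
       forall x x', Om x -> Om x' -> enorm (x - x') < d ->
         `|K x y - K x' y| < e} ->
  0 < r1 -> r1 <= r0 -> 0 < c0 -> c0 <= C0 ->
  (forall x y, Om x -> Om y ->
     C0 * \1_(Om `&` eball x r0) y >= K x y /\
     K x y >= c0 * \1_(Om `&` eball x r1) y) ->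
  (lambda_p mu Om K a = lambda_p' mu Om K a /\
   lambda_p' mu Om K a = lambda_p'' mu Om K a) /\
  ((forall x y, Om x -> Om y -> K x y = K y x) ->
   lambda_p mu Om K a = lambda_v mu Om K a).

Proof.
move=> lmu oOm cOm Om0 bOm ca _ K_ge0 mK Kuc r1_gt0 r01 c0_gt0 cC HK.
have [rho rho0 Hrho] := @normr_lt_enorm R N r1 r1_gt0.
have K_le x y : Om x -> Om y -> K x y <= C0.
  move=> Ox Oy; have [h _] := HK x y Ox Oy; apply: le_trans h _.
  rewrite ler_piMr ?indicE ?lern1 ?leq_b1//.
  by apply: le_trans cC; exact: ltW.
have K_ge x y : Om x -> Om y -> `|y - x| < rho -> c0 <= K x y.
  move=> Ox Oy yx; have [_] := HK x y Ox Oy; apply: le_trans.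
  by rewrite indicE mem_set ?mulr1//; split => //; exact: Hrho.
have Kuc' : {ae mu, forall y, Om y -> unif_continuous_on Om (K^~ y)}.
  apply: filterS Kuc => y h Oy e e0; have [d d0 Hd] := h Oy e e0.
  have [d' d'0 Hd'] := @normr_lt_enorm R N d d0.
  by exists d' => // x x' Ox Ox' /Hd'; exact: Hd.
have [k [bk k_ge Kk]] :=
  exists_bounded_kernel oOm c0_gt0 cC mK Kuc' K_ge0 K_le K_ge.
have C0_gt0 : 0 < C0 by exact: lt_le_trans cC.
have mOm : measurable Om by exact: open_measurable_rV.
(* For fixed [x] the two kernels differ on a null set of [y], so the operators agree at every point
   of [Om] and for every [f]. *)
have LE f x : Om x -> Lop mu Om K f x = Lop mu Om k f x.
  move=> Ox; apply: Rintegral_ae_eq; apply: filterS (Kk _ Ox) => y h Oy.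
  by rewrite h.
have LE' f g x : Om x -> {ae mu, forall y, Om y -> f y = g y} ->
    Lop mu Om K f x = Lop mu Om k g x.
  move=> Ox fg; rewrite LE//; apply: Rintegral_ae_eq.
  by apply: filterS fg => y h Oy; rewrite h.
pose P := [set l : R | exists phi, supersolution mu Om k a l phi].
have P0 : P !=set0.
  by have [l Hl] := exists_supersolution lmu oOm bOm Om0 bk ca; exists l, (cst 1).
have ubP : has_ubound P.
  have [x Ox] := Om0; exists (- a x) => l [phi Hphi].
  by have := supersolution_opp_ge0 bk Hphi Ox; lra.
pose Ls := sup P.
have ub l phi : supersolution mu Om k a l phi -> l <= Ls.
  by move=> h; apply: ub_le_sup => //; exists phi.
have lub d : 0 < d -> exists l phi, supersolution mu Om k a l phi /\ Ls - d < l.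
  move=> d0; have [l [phi Hl] ll] := sup_adherent d0 (conj P0 ubP).
  by exists l, phi.
have lpE : lambda_p mu Om K a = Ls%:E.
  rewrite /lambda_p -ereal_sup_EFin//; congr (ereal_sup (image _ _)).
  apply/seteqP; split => l [phi [h1 h2 h3]]; exists phi; split => // x Ox;
    by have := h3 _ Ox; rewrite LE.
have Cc_sub l : (exists phi, C_c Om phi /\ subsolution mu Om k a l phi) ->
    (lambda_p'' mu Om K a <= l%:E)%E.
  move=> [phi [cphi [p0 pn Hp]]]; apply: ge_ereal_inf; exists l%:E => //.
  exists l => //; exists phi; split => // x Ox.
  by rewrite LE// Hp.
have p''_le : (lambda_p'' mu Om K a <= Ls%:E)%E.
  apply/lee_addgt0Pr => e e0; rewrite -EFinD; apply: Cc_sub.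
  exact: (exists_C_c_subsolution lmu oOm cOm bOm Om0 bk C0_gt0 c0_gt0 rho0 k_ge ca ub lub).
have p'_le : (lambda_p' mu Om K a <= lambda_p'' mu Om K a)%E.
  apply: ereal_inf_le_tmp => _ [l [phi [cphi p0 pn Hp]] <-]; exists l => //.
  exists phi; split => //; first by have [] := cphi.
  have [M HM] := C_c_bounded cphi; split.
    exists phi; split; last exact: aeW.
    by apply: continuous_measurable_within => //; have [] := cphi.
  by exists M; exact: aeW.
have p'_ge : (Ls%:E <= lambda_p' mu Om K a)%E.
  apply: le_ereal_inf_tmp => _ [l [phi [cphi [_ [M HM]] p0 pn Hp]] <-].
  rewrite lee_fin; apply: ge_sup => // l' [psi Hpsi].
  apply: (supersolution_le_subsolution (M := M) lmu oOm bOm Om0 bk ca Hpsi).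
  - exact: continuous_measurable_within.
  (* The comparison needs a bound everywhere; continuity upgrades the essential bound. *)
  - apply: (within_continuous_ae_le lmu oOm cphi).
    by apply: filterS HM => x h Ox; apply: le_trans (ler_norm _) (h Ox).
  - by split => // x Ox; rewrite -LE// Hp.
have p''E : lambda_p'' mu Om K a = Ls%:E.
  by apply/eqP; rewrite eq_le p''_le (le_trans p'_ge).
have p'E : lambda_p' mu Om K a = Ls%:E.
  by apply/eqP; rewrite eq_le p'_ge -p''E p'_le.
split; first by rewrite lpE p'E p''E.
move=> Ksym; rewrite lpE.
have Lsa := Lop_self_adjoint oOm bOm Om0 bk Kk Kuc' Ksym.
apply/eqP; rewrite eq_le; apply/andP; split.
(* A test function [psi] is only almost everywhere equal to a Borel [g]; both integrals of its
   quotient are rewritten in terms of [g] before the supersolution bound applies. *)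
- apply: le_ereal_inf_tmp => _ [q [psi [[[g [mg psig]] psi2] psin ->]] <-].
  have g2E : {ae mu, forall y, Om y -> psi y ^+ 2 = g y ^+ 2}.
    by apply: filterS psig => y h Oy; rewrite h.
  have mg2 : measurable_fun Om (fun x => g x ^+ 2) by exact: measurable_funX.
  have ig2 : mu.-integrable Om (EFin \o (fun x => g x ^+ 2)).
    apply/integrableP; split; first exact/measurable_EFinP.
    rewrite (integral_ae_eq g2E) in psi2; apply: le_lt_trans psi2.
    rewrite le_eqVlt; apply/orP; left; apply/eqP; apply: eq_integral => x _ /=.
    by rewrite ger0_norm ?sqr_ge0.
  have g2_gt0 : 0 < \int[mu]_(x in Om) (g x ^+ 2).
    rewrite lt_neqAle Rintegral_ge0 ?andbT => [|x _]; last exact: sqr_ge0.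
    apply/eqP => g20; apply: psin.
    have := Rintegral_eq0_ae mOm ig2 (fun x _ => sqr_ge0 (g x)) (esym g20).
    apply: filterS2 psig => y h1 h2 Oy; rewrite h1//.
    by apply/eqP; rewrite -sqrf_eq0 h2.
  rewrite (Rintegral_ae_eq g2E).
  rewrite (@Rintegral_ae_eq _ _ _ mu Om
    (fun x => (Lop mu Om K psi x + a x * psi x) * psi x)
    (fun x => (Lop mu Om k g x + a x * g x) * g x)); last first.
    by apply: filterS (psig) => x h Ox; rewrite (LE' psi g x Ox psig) h.
  rewrite lee_fin; apply: ge_sup => // l [phi Hphi].
  rewrite ler_pdivlMr//.
  exact: (supersolution_variational lmu oOm bOm Om0 bk ca Lsa Hphi).
- rewrite -p''E; apply: le_ereal_inf_tmp => _ [l [phi [cphi p0 [x0 [Ox0 px0]] Hp]] <-].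
  have [cont _] := cphi; have [M HM] := C_c_bounded cphi.
  have mphi : measurable_fun Om phi by exact: continuous_measurable_within.
  have muOm := lebesgue_bounded_lty lmu mOm bOm.
  have mphi2 : measurable_fun Om (fun x => phi x ^+ 2) by exact: measurable_funX.
  have i2 : mu.-integrable Om (EFin \o (fun x => phi x ^+ 2)).
    apply: (bounded_integrable mOm muOm mphi2 (M := M ^+ 2)) => x Ox.
    by rewrite normrX lerXn2r ?nnegrE ?HM// (le_trans _ (HM _ Ox)).
  (* Admissible subsolutions are nonzero at a point, whereas Rayleigh test functions must be nonzero
     in the almost everywhere sense; continuity bridges the gap. *)
  have nae : ~ {ae mu, forall y, Om y -> phi y = 0}.
    move=> h; have : phi x0 <= 0.
      apply: (within_continuous_ae_le lmu oOm cont) => //.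
      by apply: filterS h => y h Oy; rewrite h.
    by apply/negP; rewrite -ltNge lt_neqAle eq_sym px0 p0.
  have phi2_gt0 : 0 < \int[mu]_(x in Om) (phi x ^+ 2).
    rewrite lt_neqAle Rintegral_ge0 ?andbT => [|x _]; last exact: sqr_ge0.
    apply/eqP => p20; apply: nae.
    have := Rintegral_eq0_ae mOm i2 (fun x _ => sqr_ge0 (phi x)) (esym p20).
    by apply: filterS => y h Oy; apply/eqP; rewrite -sqrf_eq0 h.
  apply: ge_ereal_inf; exists (- Rintegral mu Om
      (fun x => (Lop mu Om K phi x + a x * phi x) * phi x)
      / Rintegral mu Om (fun x => phi x ^+ 2))%:E; last first.
    rewrite lee_fin ler_pdivrMr//.
    rewrite (@eq_Rintegral _ _ _ mu Om
      (fun x => (Lop mu Om k phi x + a x * phi x) * phi x)); last first.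
      by move=> x /set_mem Ox; rewrite LE.
    apply: (subsolution_variational lmu oOm bOm Om0 bk ca) => //.
    by split => //; [exists x0|move=> x Ox; rewrite -LE// Hp].
  eexists; last by reflexivity.
  exists phi; split => //; split; first by exists phi; split => //; exact: aeW.
  have /integrableP[_] := i2; apply: le_lt_trans.
  rewrite le_eqVlt; apply/orP; left; apply/eqP; apply: eq_integral => x _ /=.
  by rewrite ger0_norm ?sqr_ge0.
Qed.
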